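(* Let $B,W$ be independent standard one-dimensional Brownian motions with $W_0=0$, $B_0=x$ under $\mathbf{P}^x$. Let $\beta\in\mathbb{R}$ and real numbers $a,b,a',b',a_0,b_0$ satisfy $a<a_0\le b_0<b$ and $a\le a'<b'\le b$. For $t>0$ define $$\overline{X}_t:=-\ln\inf_{x\in[a_0,b_0]}\mathbf{P}^{x}\big(\forall_{s\in[0,t]}\ \beta W_s+a\le B_s\le \beta W_s+b,\ \beta W_t+a'\le B_t\le \beta W_t+b'\ \big|\ W\big).$$ Then for any $t>0$, $p>0$ and $q>1$, $$\lim_{n\to+\infty}n^p\,\mathbf{P}\big(\overline{X}_t\ge(\ln n)^q\big)=0.$$ Consequently, $\mathbf{E}(\overline{X}_t^{\,j})<+\infty$ for every $j\in\mathbb{N}$ and every $t>0$.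
   Context: $\mathbf{P}^x(\cdot\mid W)$ is the conditional probability given the whole path of $W$; $\overline{X}_t$ is thus a random variable depending on $W$, and $\mathbf{P},\mathbf{E}$ refer to the law of $W$. *)

(* Defs.v *)
From HB Require Import structures.
From mathcomp Require Import all_boot all_order all_algebra.
From mathcomp Require Import all_classical all_reals all_analysis.
From mathcomp Require Import normal_distribution.
Set Implicit Arguments. Unset Strict Implicit. Unset Printing Implicit Defensive.
Import Order.TTheory GRing.Theory Num.Theory.
Import numFieldNormedType.Exports.
Local Open Scope classical_set_scope.
Local Open Scope ring_scope.

(* A standard one-dimensional Brownian motion started at 0 on the probability
   space (T, P), indexed by times t >= 0 (values at t < 0 are irrelevant):
   - B_0 = 0,
   - every path t |-> B t w is continuous on [0, +oo),
   - each B t (t >= 0) is measurable,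
   - for 0 <= t_0 < t_1 < ... < t_n the increments B_{t_{i+1}} - B_{t_i} are
     independent with law N(0, t_{i+1} - t_i) (standard deviation
     sqrt (t_{i+1} - t_i)); this is expressed as the joint product rule. *)
Definition brownian_motion {R : realType} {d : measure_display}
    {T : measurableType d} (P : probability T R) (B : R -> T -> R) : Prop :=
  [/\ (forall w, B 0 w = 0),
      (forall w, {within `[0, +oo[%classic, continuous (fun t => B t w)}),
      (forall t, 0 <= t -> measurable_fun setT (B t)) &
      (forall (n : nat) (ts : nat -> R) (A : nat -> set R),
         0 <= ts 0%N ->
         (forall i, (i < n)%N -> ts i < ts i.+1) ->
         (forall i, measurable (A i)) ->
         P [set w | forall i, (i < n)%N -> A i (B (ts i.+1) w - B (ts i) w)]
         = (\prod_(i < n)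
              fine (normal_prob 0 (Num.sqrt (ts i.+1 - ts i)) (A i)))%:E)].

(* P^x( forall s in [0,t], beta W_s + a <= B_s <= beta W_s + b,
        beta W_t + a' <= B_t <= beta W_t + b' | W ), evaluated at the
   path w2 of W.  B and W are independent: B lives on (T1,P1), W on (T2,P2),
   and B under P^x is x + B (B standard, started at 0). *)
Definition cond_prob {R : realType} {d1 d2 : measure_display}
    {T1 : measurableType d1} {T2 : measurableType d2}
    (P1 : probability T1 R) (B : R -> T1 -> R) (W : R -> T2 -> R)
    (beta a b a' b' t x : R) (w2 : T2) : \bar R :=
  P1 [set w1 |
      (forall s, 0 <= s <= t ->
          beta * W s w2 + a <= x + B s w1 <= beta * W s w2 + b) /\
      beta * W t w2 + a' <= x + B t w1 <= beta * W t w2 + b'].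

Definition Xbar {R : realType} {d1 d2 : measure_display}
    {T1 : measurableType d1} {T2 : measurableType d2}
    (P1 : probability T1 R) (B : R -> T1 -> R) (W : R -> T2 -> R)
    (beta a b a' b' a0 b0 t : R) (w2 : T2) : \bar R :=
  let m := ereal_inf
    [set cond_prob P1 B W beta a b a' b' t x w2 | x in [set x | a0 <= x <= b0]] in
  if m == 0%E then +oo%E else (- ln (fine m))%:E.

(* Main.v *)
Require Import Defs.
From HB Require Import structures.
From mathcomp Require Import all_boot all_order all_algebra.
From mathcomp Require Import all_classical all_reals all_analysis.
From mathcomp Require Import normal_distribution measurable_realfun.
From mathcomp Require Import zify ring lra.
Set Implicit Arguments. Unset Strict Implicit. Unset Printing Implicit Defensive.
Import Order.TTheory GRing.Theory Num.Theory.
Import numFieldNormedType.Exports.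
Local Open Scope classical_set_scope.
Local Open Scope ring_scope.

(** Split [0, t] into [N] steps of length [D = t / N].  Off an event of
probability [O(N exp (- c N))], the path of [W] oscillates little on every step
(chaining over dyadic times) and the normalised squared increments of [W] add
up to at most [145 N] (a chi-square tail).  For such a path, force every
increment of [B] into a window of width [2 k / N] around the increment of
[beta W] plus a drift towards the middle of [a', b'], and ask [B] to oscillate
little on each step: [B] then stays in the tube.  A window has probability at
least [(2 c / N) exp (- beta^2 dW^2 / D)], which dominates the probability of a
large oscillation because the increments of [W] are small; so the steps, being
independent, give [Xbar <= N (ln N + K)].  Taking [N ~ (ln n) `^ r] with
[1 < r < q] yields the limit, and summing over [N] yields the moments. *)

(** A typical path of [beta * W] is outside the Cameron-Martin space, so following it exactly has
    infinite cost. Following it on a grid only costs an exponent of order [beta^2 dW^2 / D] per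
    step, and the discrete quadratic variation of [W] keeps the total linear in [N]. Errors at the
    grid points add up over the [N] steps, so a window must have width of order [1 / N]: this is the
    source of the factor [ln N]. The starting point enters only through the drift [(y - x) / N],
    where [|y - x| <= b - a]; the bound is therefore uniform in [x] and passes to the infimum. The
    condition [q > 1] comes from a trade-off: [exp (- c N)] beats every power of [n] only if [N] is
    of larger order than [ln n], while [N ln N] must stay below the power [q] of [ln n]. Finally,
    [brownian_motion] gives independence only for rectangles of increments at finitely many times,
    so the oscillation over a whole step is reached through dyadic levels and a monotone limit. *)

(** * Gaussian tails and small windows *)

Section gaussian_bounds.
Context {R : realType}.
Implicit Types s u c d h : R.

Lemma measurable_norm_ge u : measurable [set x : R | u <= `|x|].
Proof.
rewrite -[X in measurable X]setTI.
rewrite (_ : [set x | _] = (fun x : R => `|x|) @^-1` `[u, +oo[); last first.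
  by apply/seteqP; split => x/=; rewrite in_itv/= andbT.
exact: (@normr_measurable R setT).
Qed.

Lemma measurable_norm_gt u : measurable [set x : R | u < `|x|].
Proof.
rewrite -[X in measurable X]setTI.
rewrite (_ : [set x | _] = (fun x : R => `|x|) @^-1` `]u, +oo[); last first.
  by apply/seteqP; split => x/=; rewrite in_itv/= andbT.
exact: (@normr_measurable R setT).
Qed.

Lemma normal_pdf0E s x : s != 0 ->
  normal_pdf 0 s x = normal_peak s * expR (- x ^+ 2 / (s ^+ 2 *+ 2)).
Proof. by move=> s0; rewrite normal_pdfE// /normal_fun subr0. Qed.

(* Half of the Gaussian exponent is kept as a density, of standard deviation
   [sqrt 2 * s]; the other half gives the decay. *)
Lemma normal_prob_tail s u : 0 < s -> 0 <= u ->
  (normal_prob 0 s [set x | (u <= `|x|)%R]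
   <= (2 * expR (- (u ^+ 2 / (4 * s ^+ 2))))%:E)%E.
Proof.
move=> s0 u0.
have sn0 : s != 0 by rewrite gt_eqF.
have s2 : 0 < Num.sqrt 2 * s by rewrite mulr_gt0// sqrtr_gt0.
have mA := measurable_norm_ge u.
have mpdf s' : measurable_fun [set: R] (fun x => (normal_pdf 0 s' x)%:E).
  by apply/measurable_EFinP; exact: measurable_normal_pdf.
set c := 2 * _.
have c0 : 0 <= c by rewrite mulr_ge0// expR_ge0.
rewrite /normal_prob.
apply: (@le_trans _ _ (\int[lebesgue_measure]_(x in [set x | (u <= `|x|)%R])
     (c%:E * (normal_pdf 0 (Num.sqrt 2 * s) x)%:E))%E); last first.
  apply: (@le_trans _ _ (\int[lebesgue_measure]_x
     (c%:E * (normal_pdf 0 (Num.sqrt 2 * s) x)%:E))%E).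
    apply: ge0_subset_integral => //.
      by apply: emeasurable_funM => //; exact: mpdf.
    by move=> x _; rewrite -EFinM lee_fin mulr_ge0// normal_pdf_ge0.
  rewrite ge0_integralZl//; [|exact: mpdf|]; last first.
    by move=> x _; rewrite lee_fin normal_pdf_ge0.
  by rewrite integral_normal_pdf mule1.
apply: ge0_le_integral => //.
- by move=> x _; rewrite lee_fin normal_pdf_ge0.
- exact: measurable_funTS (mpdf s).
- by apply: measurable_funTS; apply: emeasurable_funM => //; exact: mpdf.
move=> x /= ux; rewrite -EFinM lee_fin !normal_pdf0E ?gt_eqF//.
have -> : normal_peak s = Num.sqrt 2 * normal_peak (Num.sqrt 2 * s).
  rewrite /normal_peak exprMn sqr_sqrtr//.
  have -> : 2 * s ^+ 2 * pi *+ 2 = 2 * (s ^+ 2 * pi *+ 2) :> R by ring.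
  rewrite sqrtrM// invrM; last 2 first.
  - by rewrite unitfE gt_eqF// sqrtr_gt0.
  - rewrite unitfE gt_eqF// sqrtr_gt0 mulrn_wgt0// mulr_gt0 ?pi_gt0//.
    by rewrite exprn_gt0.
  by rewrite mulrCA divff ?mulr1// gt_eqF// sqrtr_gt0.
rewrite /c exprMn sqr_sqrtr//.
have -> : - x ^+ 2 / (s ^+ 2 *+ 2) =
    - (x ^+ 2 / (4 * s ^+ 2)) + - x ^+ 2 / ((2 * s ^+ 2) *+ 2) by field.
rewrite expRD; set p := normal_peak _; set e := expR (_ / _).
have p0 : 0 <= p by exact: normal_peak_ge0.
have e0 : 0 <= e by exact: expR_ge0.
rewrite mulrACA ler_wpM2r ?mulr_ge0//.
have sq2 : Num.sqrt 2 <= 2 :> R.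
  by rewrite -[leRHS]ger0_norm// -sqrtr_sqr ler_wsqrtr// expr2; lra.
apply: ler_pM; rewrite ?sqrtr_ge0 ?expR_ge0//.
rewrite ler_expR lerN2 ler_wpM2r//.
  by rewrite invr_ge0 mulr_ge0// sqr_ge0.
by rewrite -[leRHS]real_normK ?num_real// ler_sqr// ?nnegrE.
Qed.

Lemma normal_prob_itv_ge s c d h : 0 < s -> c < d ->
  - h <= c -> d <= h ->
  (((d - c) * (normal_peak s * expR (- h ^+ 2 / (s ^+ 2 *+ 2))))%:E
   <= normal_prob 0 s `[c, d])%E.
Proof.
move=> s0 cd hc dh; rewrite /normal_prob.
set k := normal_peak s * _.
have <- : (\int[lebesgue_measure]_(x in `[c, d]) (cst k%:E x) = ((d - c) * k)%:E)%E.
  by rewrite integral_cst//= lebesgue_measure_itv/= lte_fin cd -EFinD -EFinM mulrC.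
apply: ge0_le_integral => //.
- move=> x _; rewrite lee_fin mulr_ge0 ?expR_ge0//.
  exact: normal_peak_ge0.
- by apply: measurable_funTS; apply/measurable_EFinP; exact: measurable_normal_pdf.
move=> x /=; rewrite in_itv/= => /andP[cx xd].
rewrite lee_fin normal_pdf0E ?gt_eqF// ler_wpM2l ?normal_peak_ge0//.
rewrite ler_expR ler_wpM2r ?invr_ge0 ?mulrn_wge0 ?sqr_ge0// lerN2.
by rewrite -subr_ge0 subr_sqr mulr_ge0//; lra.
Qed.

End gaussian_bounds.

(** * Chaining over dyadic points, for a deterministic function *)

Section dyadic_chaining.
Context {R : realType}.
Implicit Types (f : R -> R) (u T k : R).

Definition dyadic T (m j : nat) : R := T * (j%:R / 2 ^+ m).

Lemma dyadic0 T m : dyadic T m 0 = 0.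
Proof. by rewrite /dyadic mul0r mulr0. Qed.

Lemma dyadic_double T m j : dyadic T m.+1 j.*2 = dyadic T m j.
Proof.
rewrite /dyadic -muln2 natrM exprS.
have : 2 ^+ m != 0 :> R by rewrite expf_neq0.
by set x := 2 ^+ m => x0; field.
Qed.

Lemma dyadic_full T m : dyadic T m (2 ^ m) = T.
Proof. by rewrite /dyadic natrX divff ?mulr1// expf_neq0. Qed.

Lemma dyadic_ge0 T m j : 0 <= T -> 0 <= dyadic T m j.
Proof. by move=> T0; rewrite mulr_ge0// divr_ge0// exprn_ge0. Qed.

Lemma dyadic_le T m j : 0 <= T -> (j <= 2 ^ m)%N -> dyadic T m j <= T.
Proof.
move=> T0 jm; rewrite -[leRHS](dyadic_full T m) /dyadic ler_wpM2l//.
by rewrite ler_wpM2r ?invr_ge0 ?exprn_ge0// ler_nat.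
Qed.

Lemma dyadicS T m j : dyadic T m j.+1 = dyadic T m j + T / 2 ^+ m.
Proof. by rewrite /dyadic -natr1 mulrDl mulrDr mul1r. Qed.

(* Weights that are summable, while the variance-normalised squares
   [weight l ^+ 2 * 2 ^+ l] still grow. *)
Definition weight (l : nat) : R := 5^-1 * (4 / 5) ^+ l.

Lemma weight_ge0 l : 0 <= weight l.
Proof. by rewrite mulr_ge0 ?invr_ge0// exprn_ge0// divr_ge0. Qed.

Lemma weight_sum m : \sum_(l < m) weight l = 1 - (4 / 5) ^+ m.
Proof.
elim: m => [|m IH]; first by rewrite big_ord0 expr0 subrr.
rewrite big_ord_recr/= IH /weight exprS; set x := (4 / 5) ^+ m; lra.
Qed.

(** An increment at level [l] has variance proportional to [2 ^- l], so this quantity is its rate of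
    Gaussian decay. Since [(4/5)^2 * 2 = 1 + 7/25] exceeds 1, Bernoulli's inequality gives growth
    linear in [l], enough to pay for the [2 ^ l] increments of that level. *)
Lemma weight_sqr_ge l : (1 + l%:R * (7 / 25)) / 25 <= weight l ^+ 2 * 2 ^+ l.
Proof.
have -> : weight l ^+ 2 * 2 ^+ l = (1 + 7 / 25) ^+ l / 25.
  rewrite /weight exprMn -!exprM mulnC exprM -mulrA -exprMn.
  have -> : (4 / 5) ^+ 2 * 2 = 1 + 7 / 25 :> R by field.
  by rewrite mulrC; congr (_ * _); field.
rewrite ler_wpM2r//.
elim: l => [|l IH]; first by rewrite mul0r addr0 expr0.
rewrite exprS -natr1.
have := ler_wpM2l (_ : 0 <= 1 + 7 / 25 :> R) IH; set x := _ ^+ l.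
have : 0 <= l%:R :> R by [].
move: (l%:R) => y y0 /(_ ltac:(lra)); lra.
Qed.

(** The oscillation budget [k] is shared among the levels by weights of total mass 1. Only countably
    many increments are constrained, so for a Brownian path this is an event. *)
Definition dyadic_tame f u T k := forall l j, (j < 2 ^ l)%N ->
  `|f (u + dyadic T l j.+1) - f (u + dyadic T l j)| <= k * weight l.

(** An even index at level [m.+1] is a point of level [m], and an odd one lies a single increment
    beyond such a point. Each level thus costs one weight, and the induction carries the partial sum
    of the weights. *)
Lemma dyadic_tame_bound f u T k : 0 <= k -> dyadic_tame f u T k ->
  forall m j, (j <= 2 ^ m)%N -> `|f (u + dyadic T m j) - f u| <= k.
Proof.
move=> k0 ft m j jm.
suff : `|f (u + dyadic T m j) - f u| <= k * \sum_(l < m.+1) weight l.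
  move/le_trans; apply; by rewrite weight_sum ler_piMr// lerBlDr lerDl.
elim: m j jm => [|m IH] j jm.
  case: j jm => [|[|//]] jm.
    by rewrite dyadic0 addr0 subrr normr0 mulr_ge0// sumr_ge0// => *; exact: weight_ge0.
  by have := ft 0%N 0%N isT; rewrite dyadic0 addr0 big_ord1.
have IHj : `|f (u + dyadic T m.+1 (j./2).*2) - f u| <= k * \sum_(l < m.+1) weight l.
  by rewrite dyadic_double IH// -(doubleK (2 ^ m)%N) half_leq// -mul2n -expnS.
rewrite big_ord_recr/= mulrDr.
rewrite -(odd_double_half j); have [oj|_] := boolP (odd j); last first.
  rewrite add0n (le_trans IHj)// lerDl mulr_ge0//; exact: weight_ge0.
rewrite add1n -(subrK (f (u + dyadic T m.+1 (j./2).*2)) (f (u + dyadic _ _ _.+1))).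
rewrite -addrA (le_trans (ler_normD _ _))// [leRHS]addrC lerD//.
apply: ft; rewrite -(odd_double_half j) oj in jm.
by rewrite add1n in jm.
Qed.

Lemma dyadic_dense_gt0 T s : 0 < T -> 0 <= s <= T ->
  exists j : nat -> nat, (forall m, (j m <= 2 ^ m)%N) /\
    dyadic T m (j m) @[m --> \oo] --> s.
Proof.
move=> T0 /andP[s0 sT].
pose j m := Num.truncn (s / T * 2 ^+ m).
have ej m : (j m)%:R <= s / T * 2 ^+ m < (j m).+1%:R.
  by apply: truncn_itv; rewrite mulr_ge0 ?exprn_ge0// divr_ge0// ltW.
exists j; split.
  move=> m; rewrite -(ler_nat R) natrX.
  have /andP[/le_trans -> //] := ej m.
  by rewrite ger_pMl ?exprn_gt0// ler_pdivrMr// mul1r.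
apply/cvgrPdist_le => e e0.
have /cvgrPdist_le/(_ e e0) : T * (2^-1 : R) ^+ m @[m --> \oo] --> (0 : R).
  rewrite -(mulr0 T); apply: cvgMr; apply: cvg_expr.
  by rewrite ger0_norm// invf_lt1//; lra.
apply: filterS => m; rewrite sub0r normrN.
move=> /(le_trans _); apply.
rewrite [leRHS]ger0_norm; last by rewrite mulr_ge0 ?(ltW T0)// exprn_ge0.
have /andP[h1 h2] := ej m.
have p2 : 0 < 2 ^+ m :> R by rewrite exprn_gt0.
have -> : s - dyadic T m (j m) = T * (2^-1) ^+ m * (s / T * 2 ^+ m - (j m)%:R).
  by rewrite /dyadic exprVn; field; rewrite !gt_eqF.
rewrite normrM ger0_norm; last by rewrite mulr_ge0 ?(ltW T0)// exprn_ge0.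
rewrite ger_pMr; last by rewrite mulr_gt0// exprn_gt0.
by rewrite ger0_norm ?subr_ge0// lerBlDr addrC natr1 ltW.
Qed.

Lemma dyadic_dense T s : 0 <= T -> 0 <= s <= T ->
  exists j : nat -> nat, (forall m, (j m <= 2 ^ m)%N) /\
    dyadic T m (j m) @[m --> \oo] --> s.
Proof.
rewrite le_eqVlt => /predU1P[<-|]; last exact: dyadic_dense_gt0.
rewrite -eq_le => /eqP <-; exists (fun=> 0%N); split => //.
under eq_fun do rewrite dyadic0.
exact: cvg_cst.
Qed.

End dyadic_chaining.

(** * From dyadic times to all times by path continuity *)

Section half_line_continuity.
Context {R : realType}.

Lemma within_cvg_seq (f : R -> R) (s_ : nat -> R) (s : R) :
  {within `[0, +oo[%classic, continuous f} ->
  (forall n, 0 <= s_ n) -> 0 <= s ->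
  s_ n @[n --> \oo] --> s -> f (s_ n) @[n --> \oo] --> f s.
Proof.
move=> /continuous_within_itvcyP[cf cf0] sn0 s0 scvg.
move: s0; rewrite le_eqVlt => /predU1P[s0|s0].
  subst s.
  apply/cvgrPdist_le => e e0.
  move/cvgrPdist_le : cf0 => /(_ e e0).
  move=> [/= r r0 hr]; move/cvgrPdist_lt : scvg => /(_ r r0).
  apply: filterS => n hn.
  (* Right continuity at 0 speaks of positive arguments only, so terms equal to 0 are treated
     apart. *)
  have := sn0 n; rewrite le_eqVlt => /predU1P[<-|sn_gt0].
    by rewrite subrr normr0 ltW.
  exact: hr.
apply: (cvg_comp s_ f scvg).
by apply: cf; rewrite in_itv/= andbT.
Qed.

Lemma dyadic_closed_itv (f : R -> R) (u T : R) :
  {within `[0, +oo[%classic, continuous f} -> 0 <= u -> 0 < T ->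
  forall c d : R,
  (forall m j, (j <= 2 ^ m)%N -> c <= f (u + dyadic T m j) <= d) ->
  forall s, 0 <= s <= T -> c <= f (u + s) <= d.
Proof.
move=> cf u0 T0 c d h s sT.
have [j [jm jcvg]] := dyadic_dense (ltW T0) sT.
have fcvg : f (u + dyadic T m (j m)) @[m --> \oo] --> f (u + s).
  apply: within_cvg_seq => //.
  - by move=> n; rewrite addr_ge0// dyadic_ge0// ltW.
  - by rewrite addr_ge0//; case/andP: sT.
  - by apply: cvgD => //; exact: cvg_cst.
apply/andP; split.
  apply: (ler_cvg_to (cvg_cst c) fcvg).
  by near=> m; have /andP[] := h m (j m) (jm m).
apply: (ler_cvg_to fcvg (cvg_cst d)).
by near=> m; have /andP[] := h m (j m) (jm m).
Unshelve. all: by end_near. Qed.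

End half_line_continuity.

(** * Tame Brownian paths and the probability of large oscillations *)

Section brownian_increments.
Context {R : realType} {d : measure_display} {T : measurableType d}.
Variables (P : probability T R) (B : R -> T -> R).
Hypothesis BB : brownian_motion P B.

Lemma brownian_measurable t : 0 <= t -> measurable_fun setT (B t).
Proof. by case: BB => _ _ + _; exact. Qed.

Lemma measurable_increment u v : 0 <= u -> 0 <= v ->
  measurable_fun setT (fun w => B v w - B u w).
Proof. by move=> u0 v0; apply: measurable_funB; exact: brownian_measurable. Qed.

Lemma measurable_increment_set u v (A : set R) : 0 <= u -> 0 <= v ->
  measurable A -> measurable [set w | A (B v w - B u w)].
Proof.
move=> u0 v0 mA; rewrite -[X in measurable X]setTI.
exact: (measurable_increment u0 v0).
Qed.

Lemma increment_law u v (A : set R) : 0 <= u < v -> measurable A ->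
  P [set w | A (B v w - B u w)] = normal_prob 0 (Num.sqrt (v - u)) A.
Proof.
move=> /andP[u0 uv] mA.
have [_ _ _ /(_ 1%N (fun i => if i is 0%N then u else v) (fun=> A) u0)] := BB.
rewrite big_ord1/= => H.
rewrite -[RHS]fineK ?fin_num_measure// -H//; last by case.
by congr (P _); apply/seteqP; split => w /= h; [case | exact: (h 0%N)].
Qed.

Lemma increment_tail u v c : 0 <= u < v -> 0 <= c ->
  (P [set w | (c < `|B v w - B u w|)%R]
   <= (2 * expR (- (c ^+ 2 / (4 * (v - u)))))%:E)%E.
Proof.
move=> uv c0; have /andP[u0 uv'] := uv.
have vu0 : 0 < v - u by rewrite subr_gt0.
have mle := measurable_norm_ge c; have mlt := measurable_norm_gt c.
have := @normal_prob_tail R (Num.sqrt (v - u)) c; rewrite sqrtr_gt0 => /(_ vu0 c0).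
rewrite sqr_sqrtr ?(ltW vu0)//; apply: le_trans.
rewrite (increment_law (A := [set x : R | (c < `|x|)%R]) uv)//.
apply: le_measure; rewrite ?inE//.
by move=> x /= /ltW.
Qed.

Definition tame_set u S k : set T := [set w | dyadic_tame (B ^~ w) u S k].

Let bad u S k l (j : nat) : set T :=
  [set w | (k * weight l < `|B (u + dyadic S l j.+1) w - B (u + dyadic S l j) w|)%R].

Let mbad u S k l j : 0 <= u -> 0 < S -> measurable (bad u S k l j).
Proof.
move=> u0 S0.
apply: (measurable_increment_set (A := [set x | (k * weight l < `|x|)%R])).
- by rewrite addr_ge0// dyadic_ge0// ltW.
- by rewrite addr_ge0// dyadic_ge0// ltW.
exact: measurable_norm_gt.
Qed.

Let level u S k l := \big[setU/set0]_(j < 2 ^ l) bad u S k l j.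

Let mlevel u S k l : 0 <= u -> 0 < S -> measurable (level u S k l).
Proof. by move=> u0 S0; apply: bigsetU_measurable => j _; exact: mbad. Qed.

Let tame_setCE u S k : ~` tame_set u S k = \bigcup_l level u S k l.
Proof.
apply/seteqP; split => w /=.
  move=> /existsNP[l /existsNP[j /not_implyP[jl /negP]]]; rewrite -ltNge => h.
  by exists l => //; rewrite /level -bigcup_mkord; exists j.
move=> [l _]; rewrite /level -bigcup_mkord => -[j /= jl h] /(_ l j jl).
by rewrite leNgt h.
Qed.

Lemma measurable_tame_set u S k : 0 <= u -> 0 < S ->
  measurable (tame_set u S k).
Proof.
move=> u0 S0; rewrite -[tame_set _ _ _]setCK; apply: measurableC.
by rewrite tame_setCE; apply: bigcupT_measurable => l; exact: mlevel.
Qed.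

(** Union bound over levels. With [a = k ^+ 2 / (100 * S)], each of the [2 ^ l] increments of level
    [l] exceeds its share with probability at most [2 exp (- a (1 + 7 l / 25))]. The level
    contributes at most [2 exp (- a) / 2 ^ l], and the geometric series sums to [4 exp (- a)]. *)
Lemma tame_setC_prob u S k : 0 <= u -> 0 < S -> 0 <= k ->
  11 <= k ^+ 2 / (100 * S) ->
  (P (~` tame_set u S k) <= (4 * expR (- (k ^+ 2 / (100 * S))))%:E)%E.
Proof.
move=> u0 S0 k0; set a := k ^+ 2 / _ => a11.
have e0 : 0 <= 4 * expR (- a) by rewrite mulr_ge0// expR_ge0.
apply: le_trans (epsilon_trick0 xpredT e0).
rewrite tame_setCE.
apply: le_trans (generalized_Boole_inequality _ _ _) _.
- by move=> l; exact: mlevel.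
- by apply: bigcupT_measurable => l; exact: mlevel.
apply: lee_nneseries => // l _.
apply: le_trans (Boole_inequality _ _) _; first by move=> j _; exact: mbad.
have p2 : 0 < 2 ^+ l :> R by rewrite exprn_gt0.
(* The threshold 11 comes from here: [1 + 11 * 7 / 25 >= 4], and the ratio [1 / 4] leaves [1 / 2]
   per level after counting [2 ^ l] increments. *)
have a4 : expR (- (a * (7 / 25))) <= 4^-1.
  rewrite expRN lef_pV2 ?posrE ?expR_gt0//.
  by apply: le_trans (expR_ge1Dx _); lra.
apply: (@le_trans _ _ (\sum_(j < 2 ^ l) (2 * (expR (- a) * 4^-1 ^+ l))%:E)%E).
  apply: lee_sum => j _; apply: le_trans (increment_tail _ _) _.
  - rewrite addr_ge0 ?dyadic_ge0 ?(ltW S0)//= ltrD2l dyadicS ltrDl.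
    by rewrite divr_gt0.
  - by rewrite mulr_ge0// weight_ge0.
  rewrite lee_fin ler_pM2l//.
  have -> : u + dyadic S l j.+1 - (u + dyadic S l j) = S / 2 ^+ l.
    by rewrite dyadicS; ring.
  apply: (@le_trans _ _ (expR (- a) * expR (- (a * (7 / 25))) ^+ l)); last first.
    rewrite ler_pM2l ?expR_gt0//.
    by apply: lerXn2r => //; rewrite nnegrE ?expR_ge0.
  rewrite -expRM_natl -expRD ler_expR mulrN -opprD lerN2.
  have -> : (k * weight l) ^+ 2 / (4 * (S / 2 ^+ l)) =
     a * (25 * (weight l ^+ 2 * 2 ^+ l)).
    rewrite /a; field; rewrite !gt_eqF//.
  rewrite (_ : a + _ = a * (1 + l%:R * (7 / 25))); last by ring.
  have := weight_sqr_ge (R := R) l; set X := _ ^+ 2 * _ => hX.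
  rewrite ler_wpM2l//; lra.
rewrite sumEFin sumr_const card_ord lee_fin -[_ *+ (2 ^ l)]mulr_natr !natrX exprS.
have -> : (4^-1 : R) ^+ l = (2 ^+ l)^-1 * (2 ^+ l)^-1.
  by rewrite -!exprVn -exprMn; congr (_ ^+ _); field.
by move: (expR (- a)) => e; rewrite le_eqVlt; apply/orP; left; apply/eqP; field; rewrite gt_eqF.
Qed.

End brownian_increments.

(** * Extending a product rule from pi-systems to the sigma-algebras they generate *)

Section independence.
Context {R : realType} {d : measure_display} {T : measurableType d}.
Variable P : probability T R.

Definition product_rule (N : nat) (F : nat -> set T) :=
  P (\bigcap_(k in `I_N) F k) = (\prod_(k < N) fine (P (F k)))%:E.

(* The generators are replaced by generated events one index at a time; for
   each index both sides are measures which agree on a pi-system. *)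
Lemma product_rule_sigma (N : nat) (C : nat -> set (set T)) :
  (forall k, C k `<=` measurable) -> (forall k, setI_closed (C k)) ->
  (forall k, C k setT) ->
  (forall F, (forall k, C k (F k)) -> product_rule N F) ->
  forall F, (forall k, <<s C k >> (F k)) -> product_rule N F.
Proof.
move=> Cm CI CT CP.
have sCm k : <<s C k >> `<=` measurable.
  by apply: smallest_sub; [exact: sigma_algebra_measurable|exact: Cm].
have CsC k : C k `<=` <<s C k >> by exact: sub_sigma_algebra.
suff H j : (j <= N)%N -> forall F, (forall k, <<s C k >> (F k)) ->
    (forall k, (j <= k)%N -> C k (F k)) -> product_rule N F.
  (* The claim [H] at [j = N] asks for generators at every index from [N] on; these do not enter the
     product rule, so they are replaced by [setT]. *)
  move=> F sF; pose F' k := if (k < N)%N then F k else setT.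
  have -> : product_rule N F = product_rule N F'.
    rewrite /product_rule; congr (P _ = _%:E).
      by apply: eq_bigcapr => k /= kN; rewrite /F' kN.
    by apply: eq_bigr => k _; rewrite /F' ltn_ord.
  apply: (H N) => // k; rewrite /F'.
    by case: ifP => _ //; apply: CsC.
  by rewrite ltnNge => ->.
elim: j => [_ F _ CF|j IH jN F sF CF]; first by apply: CP => k; exact: CF.
pose E A k := if k == j then A else F k.
pose rest := \bigcap_(k in [set k | (k < N)%N /\ k != j]) F k.
have mrest : measurable rest.
  by apply: bigcap_measurableType => k _; exact: sCm (sF k).
pose c := \prod_(k < N | k != Ordinal jN) fine (P (F k)).
have c0 : 0 <= c by apply: prodr_ge0 => k _; exact: fine_ge0.
have EI A : \bigcap_(k in `I_N) E A k = A `&` rest.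
  apply/seteqP; split => w.
    move=> h; split; first by have := h j jN; rewrite /E eqxx.
    by move=> k [kN kj]; have := h k kN; rewrite /E (negbTE kj).
  move=> [Aw h] k /= kN; rewrite /E; case: eqVneq => // kj; exact: h.
have EP A : \prod_(k < N) fine (P (E A k)) = c * fine (P A).
  rewrite (bigD1 (Ordinal jN))//= /E eqxx mulrC; congr (_ * _).
  by apply: eq_bigr => k kj; rewrite (negbTE (_ : (k : nat) != j)).
have FE : F = E (F j).
  by apply/funext => k; rewrite /E; case: eqVneq => // ->.
rewrite FE /product_rule EI EP.
pose m1 := mrestr P mrest; pose m2 := mscale (NngNum c0) P.
have -> : P (F j `&` rest) = m1 (F j) by [].
have mFj := sCm _ _ (sF j).
rewrite EFinM fineK ?fin_num_measure//.
have -> : (c%:E * P (F j) = m2 (F j))%E by [].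
apply: (@g_sigma_algebra_measure_unique _ R T (C j) _ (fun=> setT)) => //.
- by rewrite bigcup_const.
- move=> A CA; change (P (A `&` rest) = (c%:E * P A)%E); rewrite -EI.
  have := IH (ltnW jN) (E A).
  rewrite /product_rule => ->.
  + by rewrite EP EFinM fineK ?fin_num_measure//; exact: Cm CA.
  + by move=> k; rewrite /E; case: eqVneq => // ->; exact: CsC.
  + move=> k jk; rewrite /E; case: eqVneq => [->//|kj].
    by apply: CF; rewrite ltn_neqAle eq_sym kj.
- move=> _; change (P (setT `&` rest) < +oo)%E; rewrite setTI.
  by rewrite (le_lt_trans (probability_le1 _ _))// ltry.
Qed.

End independence.

(** * Independence of the steps and the product lower bound *)

Section tube_lower_bound.
Context {R : realType} {d : measure_display} {T : measurableType d}.
Variables (P : probability T R) (B : R -> T -> R).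
Hypothesis BB : brownian_motion P B.

Lemma dyadic_block (D : R) m k j : dyadic D m (k * 2 ^ m + j) = k%:R * D + dyadic D m j.
Proof.
rewrite /dyadic natrD natrM natrX mulrDl mulrDr mulfK; last by rewrite expf_neq0.
by rewrite mulrC.
Qed.

Section fixed_level.
Variables (D : R) (m N : nat).
Hypothesis D0 : 0 < D.

Let grid i : R := dyadic D m i.
Let incr i w := B (grid i.+1) w - B (grid i) w.

Let grid_ge0 i : 0 <= grid i. Proof. by rewrite dyadic_ge0// ltW. Qed.

Let grid_lt i : grid i < grid i.+1.
Proof. by rewrite /grid dyadicS ltrDl divr_gt0// exprn_gt0. Qed.

Let mincr i (A : set R) : measurable A -> measurable [set w | A (incr i w)].
Proof. by move=> mA; exact: (measurable_increment_set BB). Qed.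

Let cylinder k (A : nat -> set R) : set T :=
  [set w | forall i, (i < 2 ^ m)%N -> A i (incr (k * 2 ^ m + i) w)].

(** A pi-system generating the sigma-algebra of the increments inside block [k]. The rule in
    [brownian_motion] speaks of exactly such rectangles. *)
Let cylinders k : set (set T) :=
  [set cylinder k A | A in [set A | forall i, measurable (A i)]].

Let cylinder_prob k (A : nat -> set R) : (forall i, measurable (A i)) ->
  P (cylinder k A) =
  (\prod_(i < 2 ^ m) fine (normal_prob 0
      (Num.sqrt (grid (k * 2 ^ m + i).+1 - grid (k * 2 ^ m + i))) (A i)))%:E.
Proof.
move=> mA.
have [_ _ _ /(_ (2 ^ m)%N (fun i => grid (k * 2 ^ m + i)) A)] := BB.
move=> /(_ (grid_ge0 _)) H.
rewrite (_ : cylinder k A = [set w | forall i, (i < 2 ^ m)%N ->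
    A i (B (grid (k * 2 ^ m + i.+1)) w - B (grid (k * 2 ^ m + i)) w)]); last first.
  by apply/seteqP; split => w /= h i im; have := h i im; rewrite /incr addnS.
have lt_grid i : (i < 2 ^ m)%N -> grid (k * 2 ^ m + i) < grid (k * 2 ^ m + i.+1).
  by move=> _; rewrite addnS; exact: grid_lt.
rewrite (H lt_grid mA).
by congr (_%:E); apply: eq_bigr => i _; rewrite addnS.
Qed.

Let cylinders_product_rule F : (forall k, cylinders k (F k)) ->
  product_rule P N F.
Proof.
move=> cF.
have /choice[A hA] k : exists A : nat -> set R,
    (forall i, measurable (A i)) /\ F k = cylinder k A.
  by have [A mA <-] := cF k; exists A.
have mA k i : measurable (A k i) by have [] := hA k.
have FE k : F k = cylinder k (A k) by have [] := hA k.
have M0 : (0 < 2 ^ m)%N by rewrite expn_gt0.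
pose A' i := A (i %/ 2 ^ m)%N (i %% 2 ^ m)%N.
rewrite /product_rule.
have -> : \bigcap_(k in `I_N) F k = [set w | forall i, (i < N * 2 ^ m)%N -> A' i (incr i w)].
  apply/seteqP; split => w /= h.
    move=> i iN; have := h (i %/ 2 ^ m)%N; rewrite /= ltn_divLR// FE => /(_ iN).
    move=> /(_ (i %% 2 ^ m)%N (ltn_pmod _ M0)).
    by rewrite -divn_eq.
  move=> k /= kN; rewrite FE => i im.
  have := h (k * 2 ^ m + i)%N; rewrite /A' divnMDl// divn_small// addn0.
  rewrite modnMDl modn_small//; apply.
  by rewrite (leq_trans (_ : _ < k.+1 * 2 ^ m)%N)// ?leq_mul2r ?kN ?orbT// mulSn addnC ltn_add2r.
have [_ _ _ /(_ (N * 2 ^ m)%N grid A')] := BB.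
have mA' i : measurable (A' i) by exact: mA.
move=> /(_ (grid_ge0 _) (fun i _ => grid_lt i) mA') ->.
congr (_%:E).
rewrite -(big_mkord xpredT (fun i => fine (normal_prob 0 (Num.sqrt (grid i.+1 - grid i)) (A' i)))).
rewrite big_nat_mul big_mkord; apply: eq_bigr => k _.
rewrite FE cylinder_prob// [fine _%:E]/= [LHS](_ : _ =
   \prod_(0 <= i < 2 ^ m) fine (normal_prob 0
      (Num.sqrt (grid (k * 2 ^ m + i).+1 - grid (k * 2 ^ m + i))) (A k i))); last first.
  rewrite -{1}[(k * _)%N]add0n mulSn big_addn addnK.
  apply: eq_big_nat => i /andP[_ im].
  rewrite /A' [(i + _)%N]addnC divnMDl// divn_small// addn0.
  by rewrite modnMDl modn_small.
by rewrite big_mkord.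
Qed.

(** Only the grid times of level [m] enter, so the event depends on finitely many increments of
    block [k]; all times of the step are recovered by letting [m] grow. *)
Definition level_event (I : nat -> set R) r k : set T :=
  [set w | I k (B (k.+1%:R * D) w - B (k%:R * D) w) /\
    forall j, (j <= 2 ^ m)%N -> (`|B (k%:R * D + dyadic D m j) w - B (k%:R * D) w| <= r)%R].

(** Values relative to the start of the block are sums of its increments, so the event is not itself
    a rectangle. It is only generated by rectangles, hence the appeal to [product_rule_sigma]. *)
Let level_event_sigma I r k : (forall k, measurable (I k)) ->
  <<s cylinders k >> (level_event I r k).
Proof.
move=> mI.
pose T' := g_sigma_algebraType (cylinders k).
have mcyl : forall i, (i < 2 ^ m)%N ->
    measurable_fun (setT : set T') (incr (k * 2 ^ m + i)).
  move=> i im _ A mA; rewrite setTI; apply: sub_sigma_algebra => /=.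
  exists (fun j => if j == i then A else setT).
    by move=> j; case: ifP.
  apply/seteqP; split => w /=.
    by move=> /(_ i im); rewrite eqxx.
  by move=> h j jm; case: eqVneq => [->|].
have msum : forall j, (j <= 2 ^ m)%N -> measurable_fun (setT : set T')
    (fun w => B (k%:R * D + dyadic D m j) w - B (k%:R * D) w).
  elim=> [_|j IH jm].
    rewrite dyadic0 addr0.
    under eq_fun do rewrite subrr.
    exact: measurable_cst.
  rewrite (_ : (fun w => _) = (fun w => incr (k * 2 ^ m + j) w +
     (B (k%:R * D + dyadic D m j) w - B (k%:R * D) w))); last first.
    by apply/funext => w; rewrite /incr /grid -addnS !dyadic_block addrA subrK.
  apply: measurable_funD; first exact: mcyl.
  by apply: IH; exact: ltnW.
suff : measurable (level_event I r k : set T') by [].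
rewrite (_ : level_event I r k =
   ((fun w => B (k.+1%:R * D) w - B (k%:R * D) w) @^-1` I k) `&`
   \bigcap_(j in [set j | (j <= 2 ^ m)%N])
     ((fun w => B (k%:R * D + dyadic D m j) w - B (k%:R * D) w) @^-1` `[- r, r])).
  apply: measurableI.
    rewrite -[X in measurable X]setTI.
    have := msum _ (leqnn (2 ^ m)); rewrite dyadic_full.
    rewrite -natr1 mulrDl mul1r; apply => //.
  apply: bigcap_measurableType => j jm.
  rewrite -[X in measurable X]setTI.
  by apply: (msum j jm).
apply/seteqP; split => w /= [h1 h2]; split => // j jm.
  by rewrite /= in_itv/= -ler_norml; exact: h2.
by rewrite ler_norml; have := h2 j jm; rewrite /= in_itv.
Qed.

Lemma level_event_measurable I r k : (forall k, measurable (I k)) ->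
  measurable (level_event I r k).
Proof.
move=> mI.
have : <<s cylinders k >> `<=` measurable.
  apply: smallest_sub; first exact: sigma_algebra_measurable.
  move=> _ [A mA <-].
  rewrite (_ : cylinder k A = \bigcap_(i in `I_(2 ^ m)) [set w | A i (incr (k * 2 ^ m + i) w)])//.
  by apply: bigcap_measurableType => i _; exact: mincr.
by apply; exact: level_event_sigma.
Qed.

Lemma level_event_product_rule I r : (forall k, measurable (I k)) ->
  product_rule P N (level_event I r).
Proof.
move=> mI; apply: (@product_rule_sigma _ _ _ P N cylinders).
- move=> k _ [A mA <-].
  rewrite (_ : cylinder k A = \bigcap_(i in `I_(2 ^ m)) [set w | A i (incr (k * 2 ^ m + i) w)])//.
  by apply: bigcap_measurableType => i _; exact: mincr.
- move=> k _ _ [A mA <-] [A' mA' <-]; exists (fun i => A i `&` A' i).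
    by move=> i; exact: measurableI.
  apply/seteqP; split => w /= h.
    by split => i im; have [] := h i im.
  by case: h => h1 h2 i im; split; [exact: h1|exact: h2].
- by move=> k; exists (fun=> setT) => //; apply/seteqP; split.
- exact: cylinders_product_rule.
- by move=> k; exact: level_event_sigma.
Qed.

End fixed_level.

(** By hypothesis each window keeps probability [q k] once the paths that are not tame on its step
    are discarded. This gives the product bound at every level [m] with the same constant, and
    continuity from above gives it for the intersection over [m]. The event [S] is a measurable
    subset, so measurability of the target, a condition at uncountably many times, is avoided. *)
Lemma tube_lower_bound (D r : R) (N : nat) (I : nat -> set R) (q : nat -> R) :
  0 < D -> 0 <= r -> (forall k, measurable (I k)) ->
  (forall k, (k < N)%N -> 0 <= q k) ->
  (forall k, (k < N)%N -> ((q k)%:E + P (~` tame_set B (k%:R * D) D r) <=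
     P [set w | I k (B (k.+1%:R * D)%R w - B (k%:R * D)%R w)%R])%E) ->
  exists S, [/\ measurable S,
    S `<=` [set w | forall k, (k < N)%N -> I k (B (k.+1%:R * D) w - B (k%:R * D) w) /\
      forall s, 0 <= s <= D -> (`|B (k%:R * D + s) w - B (k%:R * D) w| <= r)%R] &
    ((\prod_(k < N) q k)%:E <= P S)%E].
Proof.
move=> D0 r0 mI q0 hq.
pose F m := \bigcap_(k in `I_N) level_event D m I r k.
have mlev m k : measurable (level_event D m I r k) by exact: level_event_measurable.
have mF m : measurable (F m) by apply: bigcap_measurableType => k _; exact: mlev.
exists (\bigcap_m F m); split.
- exact: bigcapT_measurable.
- move=> w Fw k kN; split; first by have [] := Fw 0%N Logic.I k kN.
  move=> s sD; rewrite ler_distl.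
  have [_ cB _ _] := BB.
  have kD0 : 0 <= k%:R * D by rewrite mulr_ge0// ltW.
  apply: (dyadic_closed_itv (cB w) kD0 D0) sD => m j jm.
  by rewrite -ler_distl; have [_] := Fw m Logic.I k kN; apply.
have Fge m : ((\prod_(k < N) q k)%:E <= P (F m))%E.
  have -> := level_event_product_rule m N D0 r mI.
  rewrite lee_fin; apply: ler_prod => k _; rewrite q0//=.
  rewrite -lee_fin fineK ?fin_num_measure//.
  have kD0 : 0 <= k%:R * D by rewrite mulr_ge0// ltW.
  have k1D0 : 0 <= k.+1%:R * D by rewrite mulr_ge0// ltW.
  have mG := measurable_tame_set BB r kD0 D0.
  have mIk := measurable_increment_set BB kD0 k1D0 (mI k).
  have fC : P (~` tame_set B (k%:R * D) D r) \is a fin_num.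
    by rewrite fin_num_measure//; exact: measurableC.
  rewrite -(leeD2rE _ _ fC).
  apply: le_trans (hq k (ltn_ord k)) _.
  apply: le_trans (measureU2 P (mlev m k) (measurableC mG)).
  apply: le_measure; rewrite ?inE//.
    by apply: measurableU => //; exact: measurableC.
  (* A path in the window is either tame, hence in the level event by chaining, or in the discarded
     set. *)
  move=> w Iw; have [tw|] := pselect (tame_set B (k%:R * D) D r w); last by right.
  by left; split => // j jm; exact: dyadic_tame_bound tw _ _ jm.
apply: (@cvge_ge _ \oo _ _ (P \o F)); first exact: nearW.
apply: nonincreasing_cvg_mu => //.
- by rewrite (le_lt_trans (probability_le1 _ _))// ltry.
- exact: bigcapT_measurable.
(* The points of level [m] are the even-indexed points of level [m.+1], so the events decrease. *)
apply/nonincreasing_seqP => m; apply/subsetPset => w Fw k kN.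
have [Iw h] := Fw k kN; split => // j jm.
by rewrite -dyadic_double; apply: h; rewrite expnS mul2n leq_double.
Qed.

End tube_lower_bound.

(** * Exponential tail of the normalised sum of squared increments *)

Section chi_square.
Context {R : realType} {d : measure_display} {T : measurableType d}.
Variables (P : probability T R) (W : R -> T -> R).
Hypothesis WW : brownian_motion P W.

(** The ratio [exp (- 1/8)] is at most [8/9], because [exp (1/8) >= 9/8], and the geometric series
    of ratio [8/9] sums to 9. *)
Lemma geometric_expR_le (M : nat) : \sum_(j < M) expR (- (j%:R / 8)) <= 9 :> R.
Proof.
pose x : R := expR (- (8^-1)).
have x0 : 0 < x by exact: expR_gt0.
have x1 : x <= 8 / 9.
  rewrite /x expRN -[leRHS]invrK lef_pV2 ?posrE ?expR_gt0//.
  by apply: le_trans (expR_ge1Dx _); lra.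
suff : \sum_(j < M) expR (- (j%:R / 8)) <= 9 * (1 - x ^+ M).
  by move/le_trans; apply; have := exprn_ge0 M (ltW x0); lra.
elim: M => [|M IH]; first by rewrite big_ord0 expr0 subrr mulr0.
rewrite big_ord_recr/= -mulrN expRM_natl -/x.
have := exprn_ge0 M (ltW x0); rewrite exprS; nra.
Qed.

Lemma bigsetU_measure_le (I : Type) (s : seq I) (Q : pred I) (F : I -> set T) :
  (forall i, measurable (F i)) ->
  (P (\big[setU/set0]_(i <- s | Q i) F i) <= \sum_(i <- s | Q i) P (F i))%E.
Proof.
move=> mF; elim: s => [|i s IH]; first by rewrite !big_nil measure0.
rewrite !big_cons; case: ifP => // _.
apply: le_trans (measureU2 _ (mF i) _) _; last exact: leeD2l.
by apply: bigsetU_measurable => j _; exact: mF.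
Qed.

Let cell (D : R) (j : nat) : set R := [set x | j%:R <= x ^+ 2 / D < j.+1%:R].

Let mcell D j : measurable (cell D j).
Proof.
rewrite -[X in measurable X]setTI.
rewrite (_ : cell D j = (fun x => x ^+ 2 / D) @^-1` `[j%:R, j.+1%:R[); last first.
  by apply/seteqP; split => x/=; rewrite in_itv.
have : measurable_fun (setT : set R) (fun x : R => x ^+ 2 / D).
  by apply: measurable_funM => //; exact: measurable_funX.
by apply.
Qed.

Let cell_prob D j : 0 < D ->
  fine (normal_prob 0 (Num.sqrt D) (cell D j)) <= 2 * expR (- (j%:R / 4)).
Proof.
move=> D0; rewrite -lee_fin fineK; last by apply: fin_num_measure; exact: mcell.
have sD : 0 < Num.sqrt D by rewrite sqrtr_gt0.
have /le_trans -> // : (normal_prob 0 (Num.sqrt D) (cell D j) <=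
   normal_prob 0 (Num.sqrt D) [set x | (Num.sqrt (j%:R * D) <= `|x|)%R])%E.
  apply: le_measure; rewrite ?inE; first exact: mcell.
    exact: measurable_norm_ge.
  move=> x /= /andP[jx _]; rewrite -sqrtr_sqr ler_wsqrtr//.
  by rewrite -ler_pdivlMr.
have jD : 0 <= j%:R * D by rewrite mulr_ge0// ltW.
have := @normal_prob_tail R (Num.sqrt D) (Num.sqrt (j%:R * D)) sD (sqrtr_ge0 _).
rewrite !sqr_sqrtr ?(ltW D0)//.
by have -> : j%:R * D / (4 * D) = j%:R / 4 by field; rewrite gt_eqF.
Qed.

(* Chernoff bound with the law of each increment discretised into finitely
   many cells, so that only finite sums and the product rule occur. *)
Lemma chi_square_tail (D : R) (N M : nat) : 0 < D ->
  exists S, [/\ measurable S,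
    [set w | (forall k, (k < N)%N -> (W (k.+1%:R * D) w - W (k%:R * D) w) ^+ 2 / D < M%:R) /\
       145 * N%:R < \sum_(k < N) (W (k.+1%:R * D) w - W (k%:R * D) w) ^+ 2 / D] `<=` S &
    (P S <= (expR (- N%:R))%:E)%E].
Proof.
move=> D0.
(* The cap [M] on the normalised squares makes the family of rectangles finite; the resulting bound
   is uniform in [M]. *)
pose rect (f : {ffun 'I_N -> 'I_M}) : set T := [set w | forall k : 'I_N,
   cell D (f k) (W (k.+1%:R * D) w - W (k%:R * D) w)].
have lt_grid k : k%:R * D < k.+1%:R * D by rewrite ltr_pM2r// ltr_nat.
have rectP f : measurable (rect f) /\
    P (rect f) = (\prod_(k < N) fine (normal_prob 0 (Num.sqrt D) (cell D (f k))))%:E.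
  pose A i := if insub i is Some k then cell D (f k) else setT.
  have mA i : measurable (A i) by rewrite /A; case: insub.
  have AE (k : 'I_N) : A k = cell D (f k) by rewrite /A valK.
  have rE : rect f = [set w | forall k, (k < N)%N -> A k (W (k.+1%:R * D) w - W (k%:R * D) w)].
    apply/seteqP; split => w /= h.
      by move=> k kN; rewrite (AE (Ordinal kN)); exact: h.
    by move=> k; rewrite -AE; exact: h.
  split.
    rewrite rE (_ : [set w | _] = \bigcap_(k in `I_N) [set w | A k (W (k.+1%:R * D) w - W (k%:R * D) w)])//.
    apply: bigcap_measurableType => k _; apply: (measurable_increment_set WW) => //.
      by rewrite mulr_ge0// ltW.
    by rewrite mulr_ge0// ltW.
  have [_ _ _ /(_ N (fun k => k%:R * D) A)] := WW.
  rewrite mul0r => /(_ (lexx _) (fun i _ => lt_grid i) mA).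
  rewrite rE => ->; congr (_%:E); apply: eq_bigr => k _.
  by rewrite AE -mulrBl -natr1 [_ + 1]addrC addrK mul1r.
(* Rounding each normalised square down to an integer loses at most 1 per step, which turns 145 into
   144. *)
pose big (f : {ffun 'I_N -> 'I_M}) := (144 * N <= \sum_k f k)%N.
exists (\big[setU/set0]_(f | big f) rect f); split.
- by apply: bigsetU_measurable => f _; exact: (rectP f).1.
- move=> w [/= hM hN].
  pose z (k : 'I_N) := (W (k.+1%:R * D) w - W (k%:R * D) w) ^+ 2 / D.
  have z0 k : 0 <= z k by rewrite divr_ge0 ?sqr_ge0// ltW.
  have tz k := truncn_itv (z0 k).
  have tM k : (Num.truncn (z k) < M)%N.
    rewrite -(ltr_nat R); have /andP[h _] := tz k.
    exact: le_lt_trans h (hM _ _).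
  pose f := [ffun k => Ordinal (tM k)].
  have bf : big f.
    rewrite /big -(ler_nat R) natrM natr_sum.
    have : \sum_k z k <= \sum_k ((f k)%:R + 1).
      by apply: ler_sum => k _; rewrite ffunE/= natr1 ltW//; case/andP: (tz k).
    rewrite big_split/= sumr_const card_ord -[1 *+ N]/(N%:R) => h.
    have := lt_le_trans hN h; rewrite (_ : 145 = 144 + 1 :> R); last by lra.
    by rewrite mulrDl mul1r ltrD2r => /ltW.
  rewrite (bigD1 f)//=; left.
  by move=> k /=; rewrite /f ffunE/=; exact: tz.
apply: le_trans (bigsetU_measure_le _ _ _) _; first by move=> f; exact: (rectP f).1.
under eq_bigr do rewrite (rectP _).2.
rewrite sumEFin lee_fin.
(* The exponent [f k / 4] is halved. One half, summed over [k] on [big], is at least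
   [144 N / 8 = 18 N]; the other half stays as a summable weight. *)
apply: (@le_trans _ _ (\sum_(f : {ffun 'I_N -> 'I_M}) (expR (- (18 * N%:R)) * \prod_(k < N) (2 * expR (- ((f k)%:R / 8)))))).
  rewrite [leRHS](bigID big)/=.
  apply: ler_wpDr.
    apply: sumr_ge0 => f _; rewrite mulr_ge0 ?expR_ge0//.
    by apply: prodr_ge0 => k _; rewrite mulr_ge0 ?expR_ge0.
  apply: ler_sum => f bf.
  apply: (@le_trans _ _ (\prod_(k < N) (expR (- ((f k)%:R / 8)) * (2 * expR (- ((f k)%:R / 8)))))).
    apply: ler_prod => k _; rewrite fine_ge0//=.
    apply: le_trans (cell_prob _ D0) _.
    by rewrite mulrCA -expRD (_ : - (_ / 8) - _ / 8 = - ((f k)%:R / 4))//; field.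
  rewrite big_split/= ler_wpM2r//.
    by apply: prodr_ge0 => k _; rewrite mulr_ge0 ?expR_ge0.
  rewrite -expR_sum ler_expR sumrN lerN2 -mulr_suml -natr_sum ler_pdivlMr//.
  by move: bf; rewrite /big -(ler_nat R) natrM; lra.
(* The sum over all [f] factorises into an [N]-th power, at most [(2 * 9) ^ N]; as [18 <= exp 17], a
   factor [exp (- N)] remains. *)
rewrite -mulr_sumr -(bigA_distr_bigA (fun (k : 'I_N) (j : 'I_M) => 2 * expR (- (j%:R / 8)))).
rewrite prodr_const card_ord -mulr_sumr.
apply: (@le_trans _ _ (expR (- (18 * N%:R)) * 18 ^+ N)).
  rewrite ler_wpM2l ?expR_ge0//; apply: lerXn2r; rewrite ?nnegrE//.
    by rewrite mulr_ge0// sumr_ge0// => j _; exact: expR_ge0.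
  by have := geometric_expR_le M; lra.
apply: (@le_trans _ _ (expR (- (18 * N%:R)) * expR 17 ^+ N)).
  rewrite ler_wpM2l ?expR_ge0//; apply: lerXn2r; rewrite ?nnegrE ?expR_ge0//.
  by apply: le_trans (expR_ge1Dx _); lra.
by rewrite -expRM_natl -expRD ler_expR; lra.
Qed.

End chi_square.

(** * Measurability of [Xbar] and its elementary bounds *)

Section conditional_probability.
Context {R : realType} {d1 d2 : measure_display} {T1 : measurableType d1}
  {T2 : measurableType d2}.
Variables (P1 : probability T1 R) (P2 : probability T2 R).
Variables (B : R -> T1 -> R) (W : R -> T2 -> R).
Variables (beta a b a' b' a0 b0 t : R).
Hypotheses (BB : brownian_motion P1 B) (WW : brownian_motion P2 W).
Hypothesis t0 : 0 < t.

Let tube x : set (T1 * T2) := [set w |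
  (forall s, 0 <= s <= t ->
     beta * W s w.2 + a <= x + B s w.1 <= beta * W s w.2 + b) /\
  beta * W t w.2 + a' <= x + B t w.1 <= beta * W t w.2 + b'].

Let gap x s (w : T1 * T2) := x + B s w.1 - beta * W s w.2.

Let gapE x s w (l u : R) : (l <= gap x s w <= u) =
  (beta * W s w.2 + l <= x + B s w.1 <= beta * W s w.2 + u).
Proof. by rewrite /gap lerBrDr lerBlDr addrC [u + _]addrC. Qed.

Let measurable_gap x s : 0 <= s -> measurable_fun setT (gap x s).
Proof.
move=> s0; apply: measurable_funB.
  apply: measurable_funD => //.
  by apply: measurableT_comp => //; exact: (brownian_measurable BB).
apply: measurable_funM => //.
by apply: measurableT_comp => //; exact: (brownian_measurable WW).
Qed.

Let measurable_gap_itv x s (l u : R) : 0 <= s ->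
  measurable [set w | l <= gap x s w <= u].
Proof.
move=> s0; rewrite -[X in measurable X]setTI.
rewrite (_ : [set w | _] = gap x s @^-1` `[l, u]); last first.
  by apply/seteqP; split => w/=; rewrite in_itv.
exact: (measurable_gap x s0).
Qed.

Let continuous_gap x w :
  {within `[0, +oo[%classic, continuous (fun s => gap x s w)}.
Proof.
have [_ cB _ _] := BB; have [_ cW _ _] := WW.
move=> s; apply: cvgB; first by apply: cvgD; [exact: cvg_cst|exact: cB].
by apply: cvgM; [exact: cvg_cst|exact: cW].
Qed.

(** The gap is continuous in time and its bounds are closed, so dyadic times suffice. Joint
    measurability on the product space is what makes the probability of the section measurable in
    the path of [W]. *)
Let measurable_tube x : measurable (tube x).
Proof.
rewrite (_ : tube x =
  (\bigcap_m \bigcap_(j in [set j | (j <= 2 ^ m)%N]) [set w | a <= gap x (dyadic t m j) w <= b])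
  `&` [set w | a' <= gap x t w <= b']).
  apply: measurableI; last by apply: measurable_gap_itv; exact: ltW.
  apply: bigcapT_measurable => m; apply: bigcap_measurableType => j _.
  by apply: measurable_gap_itv; rewrite dyadic_ge0// ltW.
apply/seteqP; split => w /=.
  move=> [h1 h2]; split; last by rewrite gapE.
  move=> m _ j /= jm; rewrite gapE; apply: h1.
  by rewrite dyadic_ge0 ?dyadic_le// ltW.
move=> [h1 h2]; split; last by rewrite -gapE.
move=> s st; rewrite -gapE.
have := dyadic_closed_itv (@continuous_gap x w) (lexx 0) t0.
move=> /(_ a b) H; have := H _ s st; rewrite add0r; apply => m j jm.
by rewrite add0r; exact: (h1 m Logic.I j jm).
Qed.

Let cond_probE x : cond_prob P1 B W beta a b a' b' t x = P1 \o ysection (tube x).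
Proof.
apply/funext => w2 /=; rewrite /cond_prob; congr (P1 _).
by apply/seteqP; split => w1; rewrite /ysection/= inE.
Qed.

Lemma measurable_cond_prob x :
  measurable_fun setT (cond_prob P1 B W beta a b a' b' t x).
Proof. by rewrite cond_probE; exact: measurable_fun_ysection. Qed.

Definition path_tube x w2 : set T1 := [set w1 |
      (forall s, 0 <= s <= t ->
          beta * W s w2 + a <= x + B s w1 <= beta * W s w2 + b) /\
      beta * W t w2 + a' <= x + B t w1 <= beta * W t w2 + b'].

Lemma measurable_path_tube x w2 : measurable (path_tube x w2).
Proof.
rewrite (_ : path_tube x w2 = ysection (tube x) w2).
  exact: measurable_ysection.
by apply/seteqP; split => w1; rewrite /ysection/= inE.
Qed.

Let limsup_path_tube (y : nat -> R) x w2 : y n @[n --> \oo] --> x ->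
  lim_sup_set (fun n => path_tube (y n) w2) `<=` path_tube x w2.
Proof.
move=> yx w1 hw.
have close s (l u : R) :
    (forall n, path_tube (y n) w2 w1 -> l <= y n + B s w1 <= u) ->
    l <= x + B s w1 <= u.
  move=> h.
  have ye (e : R) : 0 < e -> exists2 n, path_tube (y n) w2 w1 & `|x - y n| <= e.
    move=> e0; have /cvgrPdist_le/(_ e e0)[n _ hn] := yx.
    by have [j nj wj] := hw n Logic.I; exists j => //; exact: hn.
  apply/andP; split; apply/ler_addgt0Pr => e /ye[n /h /andP[h1 h2]];
    rewrite ler_distl => /andP[h3 h4]; lra.
split => [s st|].
  by apply: close => n [+ _]; exact.
by apply: close => n [_ +].
Qed.

(** Upper semicontinuity in the starting point: the constraints are closed in [x], so the upper
    limit of the tubes at [y n] lies in the tube at [x], and the reverse Fatou inequality for sets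
    applies. *)
Let cond_prob_usc (y : nat -> R) x w2 (c : \bar R) : y n @[n --> \oo] --> x ->
  (forall n, (c <= cond_prob P1 B W beta a b a' b' t (y n) w2)%E) ->
  (c <= cond_prob P1 B W beta a b a' b' t x w2)%E.
Proof.
move=> yx hc.
have mE n : measurable (path_tube (y n) w2) by exact: measurable_path_tube.
have mU n : measurable (\bigcup_(k >= n) path_tube (y k) w2).
  by apply: bigcup_measurable.
apply: (@le_trans _ _ (P1 (lim_sup_set (fun n => path_tube (y n) w2)))); last first.
  apply: le_measure; rewrite ?inE.
  - exact: bigcapT_measurable.
  - exact: measurable_path_tube.
  - exact: limsup_path_tube.
have fU : (P1 (\bigcup_(k >= 0) path_tube (y k) w2) < +oo)%E.
  by rewrite (le_lt_trans (probability_le1 _ _))// ltry.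
apply: cvge_ge (lim_sup_set_cvg P1 _ mE fU).
apply: nearW => n; apply: le_trans (hc n) _.
apply: le_measure; rewrite ?inE; [exact: mE|exact: mU|].
by move=> w h; exists n => /=.
Qed.

Let inf_prob w2 := ereal_inf
  [set cond_prob P1 B W beta a b a' b' t x w2 | x in [set x | a0 <= x <= b0]].

Hypothesis ab0 : a0 <= b0.

(** An enumeration of the dyadic points of [[a0, b0]]; the minimum keeps arbitrary pairs in
    range. *)
Let node (n : nat) : R := if unpickle n is Some (m, j) then
   a0 + dyadic (b0 - a0) m (minn j (2 ^ m)) else a0.

Let node_itv n : a0 <= node n <= b0.
Proof.
rewrite /node; case: unpickle => [[m j]|]; last by rewrite lexx.
rewrite lerDl dyadic_ge0 ?subr_ge0//= -lerBrDl.
by rewrite dyadic_le ?subr_ge0// geq_minr.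
Qed.

(** By upper semicontinuity the value at [x] is no smaller than a lower bound common to dyadic
    points tending to [x]. The infimum over an uncountable set thus becomes a countable one, which
    is measurable. *)
Let inf_probE w2 : inf_prob w2 =
  einfs (fun n => cond_prob P1 B W beta a b a' b' t (node n) w2) 0.
Proof.
apply/eqP; rewrite eq_le; apply/andP; split.
  apply: ereal_inf_le_tmp => _ [n _ <-]; exists (node n) => //.
  exact: node_itv.
apply: le_ereal_inf_tmp => _ [x /= /andP[ax xb] <-].
have [||j [jm jx]] := @dyadic_dense R (b0 - a0) (x - a0).
- by rewrite subr_ge0.
- by rewrite subr_ge0 ax lerD2r.
apply: (@cond_prob_usc (fun m => a0 + dyadic (b0 - a0) m (j m))).
  rewrite -[x in _ --> x](subrKC a0).
  by apply: cvgD => //; exact: cvg_cst.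
move=> m; apply: ereal_inf_lbound; exists (pickle (m, j m)) => //=.
by rewrite /node pickleK (minn_idPl _).
Qed.

Let measurable_inf_prob : measurable_fun setT inf_prob.
Proof.
rewrite (funext inf_probE).
by apply: measurable_fun_einfs => n; exact: measurable_cond_prob.
Qed.

Lemma measurable_Xbar :
  measurable_fun setT (Xbar P1 B W beta a b a' b' a0 b0 t).
Proof.
rewrite (_ : Xbar _ _ _ _ _ _ _ _ _ _ _ =
  (fun w => if inf_prob w == 0%E then +oo%E else (- ln (fine (inf_prob w)))%:E))//.
apply: measurable_fun_ifT => //.
  apply: (measurable_fun_bool true).
  rewrite (_ : _ @^-1` _ = inf_prob @^-1` [set 0%E]).
    by apply: measurable_inf_prob => //; exact: emeasurable_set1.
  by apply/seteqP; split => w /= /eqP.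
apply/measurable_EFinP; apply: measurableT_comp => //.
apply: measurableT_comp => //.
by apply: measurableT_comp => //; exact: fine_measurable.
Qed.

Lemma Xbar_le w2 (q : R) : 0 < q ->
  (forall x, a0 <= x <= b0 ->
     (q%:E <= cond_prob P1 B W beta a b a' b' t x w2)%E) ->
  (Xbar P1 B W beta a b a' b' a0 b0 t w2 <= (- ln q)%:E)%E.
Proof.
move=> q0 hq.
have qi : (q%:E <= inf_prob w2)%E.
  by apply: le_ereal_inf_tmp => _ [x /= xab <-]; exact: hq.
(* An infimum equal to [+oo] would be sent to 0 by [fine]; the bound by 1, from the nonempty range
   of [x], excludes it. *)
have i1 : (inf_prob w2 <= 1)%E.
  apply: (@le_trans _ _ (cond_prob P1 B W beta a b a' b' t a0 w2)).
    by apply: ereal_inf_lbound; exists a0 => //=; rewrite lexx.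
  by apply: probability_le1; exact: measurable_path_tube.
rewrite /Xbar -/(inf_prob w2).
move: qi i1; case: (inf_prob w2) => [i| |]; rewrite ?leye_eq// lee_fin => qi _.
have i0 : 0 < i by exact: lt_le_trans qi.
rewrite eqe gt_eqF// lee_fin lerN2 ler_ln//.
Qed.

Lemma Xbar_ge0 w2 : (0 <= Xbar P1 B W beta a b a' b' a0 b0 t w2)%E.
Proof.
rewrite /Xbar -/(inf_prob w2); case: ifP => // _.
have i1 : (inf_prob w2 <= 1)%E.
  apply: (@le_trans _ _ (cond_prob P1 B W beta a b a' b' t a0 w2)).
    by apply: ereal_inf_lbound; exists a0 => //=; rewrite lexx.
  by apply: probability_le1; exact: measurable_path_tube.
rewrite lee_fin oppr_ge0 ln_le0//.
by move: i1; case: (inf_prob w2) => [i| |].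
Qed.

End conditional_probability.

(** * Deterministic confinement and bounds for a single step *)

(** With [f] for the path of [B] and [g] for that of [beta * W], the difference [x + f - g] follows
    the segment from [x] to [y] up to three errors of size at most [k]: the accumulated window
    errors, the oscillation of [f] and that of [g]. The segment keeps distance [3 k] from [a] and
    [b] by convexity; at time [t] only the first error is left. *)
Lemma grid_tube {R : realType} (f g : R -> R) (N : nat) (t k x y a b a' b' : R) :
  (0 < N)%N -> 0 < t -> 0 <= k -> f 0 = 0 -> g 0 = 0 ->
  (forall i, (i < N)%N ->
    `|f (i.+1%:R * (t / N%:R)) - f (i%:R * (t / N%:R))
      - (g (i.+1%:R * (t / N%:R)) - g (i%:R * (t / N%:R)) + (y - x) / N%:R)| <= k / N%:R) ->
  (forall i, (i < N)%N -> forall s, 0 <= s <= t / N%:R ->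
    `|f (i%:R * (t / N%:R) + s) - f (i%:R * (t / N%:R))| <= k) ->
  (forall i, (i < N)%N -> forall s, 0 <= s <= t / N%:R ->
    `|g (i%:R * (t / N%:R) + s) - g (i%:R * (t / N%:R))| <= k) ->
  a + 3 * k <= x <= b - 3 * k -> a + 3 * k <= y <= b - 3 * k ->
  a' + k <= y <= b' - k ->
  (forall s, 0 <= s <= t -> g s + a <= x + f s <= g s + b) /\
  g t + a' <= x + f t <= g t + b'.
Proof.
move=> N0 t0 k0 f0 g0 hI hf hg /andP[ax xb] /andP[ay yb] /andP[ay' yb'].
set D := t / N%:R in hI hf hg *.
have Nr0 : 0 < N%:R :> R by rewrite ltr0n.
have D0 : 0 < D by rewrite divr_gt0.
have tE : t = N%:R * D by rewrite mulrC divfK// gt_eqF.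
have node i : (i <= N)%N ->
    `|f (i%:R * D) - g (i%:R * D) - i%:R * ((y - x) / N%:R)| <= i%:R * (k / N%:R).
  elim: i => [_|i IH iN]; first by rewrite !mul0r f0 g0 !subr0 normr0.
  have := IH (ltnW iN); have := hI i iN.
  rewrite !ler_norml -natr1 !mulrDl !mul1r.
  move=> /andP[h1 h2] /andP[h3 h4]; apply/andP; split; lra.
have frac i : (i <= N)%N -> exists2 c : R, 0 <= c <= 1 &
    i%:R * ((y - x) / N%:R) = c * (y - x) /\ i%:R * (k / N%:R) = c * k.
  move=> iN; exists (i%:R / N%:R).
    by rewrite divr_ge0//= ler_pdivrMr// mul1r ler_nat.
  by split; rewrite mulrAC mulrA.
split.
  move=> s /andP[s0 st].
  (* The final time [s = t] is assigned to the end of the last step, since rounding down would give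
     the index [N]. *)
  have [i [r [iN r0 rD ->]]] : exists i r, [/\ (i < N)%N, 0 <= r, r <= D & s = i%:R * D + r].
    have [sl|] := ltP s t; last first.
      move=> ts; have {st ts} -> : s = t by apply/eqP; rewrite eq_le st.
      exists N.-1, D; split; rewrite ?(ltW D0)//; first by rewrite prednK.
      by rewrite {1}tE -{1}(prednK N0) -natr1 mulrDl mul1r.
    have sD0 : 0 <= s / D by rewrite divr_ge0// ltW.
    have /andP[h1 h2] := truncn_itv sD0.
    exists (Num.truncn (s / D)), (s - (Num.truncn (s / D))%:R * D).
    rewrite subr_ge0 -ler_pdivlMr// h1; split=> //; last by rewrite subrKC.
      rewrite -(ltr_nat R) (le_lt_trans h1)// ltr_pdivrMr// -tE//.
    rewrite lerBlDl -[X in _ + X]mul1r -mulrDl natr1 -ler_pdivrMr//.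
    exact: ltW.
  have := node i (ltnW iN).
  have [c /andP[c0 c1] [-> ->]] := frac i (ltnW iN).
  have := hf i iN r; have := hg i iN r; rewrite r0 rD => /(_ isT) + /(_ isT).
  rewrite !ler_norml.
  move: (f (_ + r)) (g (_ + r)) (f (_ * D)) (g (_ * D)) => fs gs fi gi.
  move=> /andP[h1 h2] /andP[h3 h4] /andP[h5 h6].
  have ck : c * k <= k by rewrite ler_piMl.
  have cx1 : a + 3 * k <= x + c * (y - x).
    have := mulr_ge0 c0 (_ : 0 <= y - (a + 3 * k)); rewrite subr_ge0 => /(_ ay).
    have := mulr_ge0 (_ : 0 <= 1 - c) (_ : 0 <= x - (a + 3 * k)).
    rewrite !subr_ge0 => /(_ c1 ax); nra.
  have cx2 : x + c * (y - x) <= b - 3 * k.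
    have := mulr_ge0 c0 (_ : 0 <= (b - 3 * k) - y); rewrite subr_ge0 => /(_ yb).
    have := mulr_ge0 (_ : 0 <= 1 - c) (_ : 0 <= (b - 3 * k) - x).
    rewrite !subr_ge0 => /(_ c1 xb); nra.
  apply/andP; split; lra.
have := node N (leqnn _); rewrite -tE !(mulrC N%:R) !divfK ?gt_eqF//.
rewrite ler_norml => /andP[h1 h2]; apply/andP; split; lra.
Qed.

(** From [exp u >= 1 + u^2 / 2] at [u = c N], which dominates [A N] once [N > 2 A / c^2]. *)
Lemma linear_expR_le1 {R : realType} (A c : R) : 0 < A -> 0 < c ->
  exists N0 : nat, forall N, (N0 <= N)%N -> A * N%:R * expR (- (c * N%:R)) <= 1.
Proof.
move=> A0 c0; exists (Num.truncn (2 * A / c ^+ 2)).+1 => N N0.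
have AN : 2 * A / c ^+ 2 < N%:R.
  apply: lt_le_trans (truncnS_gt _) _; by rewrite ler_nat.
have Np : 0 < N%:R :> R by apply: le_lt_trans AN; rewrite divr_ge0 ?mulr_ge0 ?sqr_ge0// ltW.
rewrite expRN ler_pdivrMr ?expR_gt0// mul1r.
apply: (@le_trans _ _ (1 + (c * N%:R) ^+ 2 / 2)); last first.
  by have := @expR_ge1Dxn R (c * N%:R) 1; apply; rewrite mulr_ge0// ltW.
have : 2 * A < N%:R * c ^+ 2 by rewrite -ltr_pdivrMr// exprn_gt0.
move=> h; have := ler_wpM2r (ltW Np) (ltW h).
rewrite exprMn expr2; nra.
Qed.

Lemma normal_peak_anti {R : realType} (s u : R) : 0 < s -> s <= u ->
  normal_peak u <= normal_peak s.
Proof.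
move=> s0 su; have u0 := lt_le_trans s0 su.
have p0 v : 0 < v -> 0 < v ^+ 2 * pi *+ 2 :> R.
  by move=> v0; rewrite mulrn_wgt0// mulr_gt0 ?pi_gt0// exprn_gt0.
rewrite /normal_peak lef_pV2 ?posrE ?sqrtr_gt0 ?p0// ler_wsqrtr// lerMn2r /=.
by rewrite ler_wpM2r ?pi_ge0// ler_sqr ?nnegrE// ltW.
Qed.

(** On the window the increment is at most [h = |e| + (L + k) / N] in absolute value, and
    [h^2 <= 2 e^2 + 2 ((L + k) / N)^2]. After division by [2 D] the second term is at most
    [(L + k)^2 / t], a constant; the peak is bounded below by its value at [t], as [D <= t]. *)
Lemma increment_window_ge {R : realType} {d : measure_display}
    {T : measurableType d} (P : probability T R) (B : R -> T -> R)
    (t k L e m : R) (N i : nat) :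
  brownian_motion P B -> 0 < t -> 0 < k -> 0 <= L -> `|m| <= L -> (0 < N)%N ->
  ((2 * (k * normal_peak (Num.sqrt t) * expR (- ((L + k) ^+ 2 / t))) / N%:R *
    expR (- (e ^+ 2 / (t / N%:R))))%:E <=
  P [set w | `[(e + m / N%:R - k / N%:R)%R, (e + m / N%:R + k / N%:R)%R]%classic
     (B (i.+1%:R * (t / N%:R)) w - B (i%:R * (t / N%:R)) w)%R])%E.
Proof.
move=> BB t0 k0 L0 mL N0; set D := t / N%:R.
have Nr0 : 0 < N%:R :> R by rewrite ltr0n.
have Nr1 : 1 <= N%:R :> R by rewrite ler1n.
have D0 : 0 < D by rewrite divr_gt0.
have Dt : D <= t by rewrite ler_pdivrMr// ler_peMr// ltW.
have kN : 0 < k / N%:R by rewrite divr_gt0.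
set h := `|e| + (L + k) / N%:R.
have gd : 0 <= i%:R * D < i.+1%:R * D.
  by rewrite mulr_ge0 ?(ltW D0)//= ltr_pM2r// ltr_nat.
rewrite (increment_law BB gd)//.
have -> : i.+1%:R * D - i%:R * D = D by rewrite -mulrBl -natr1 [_ + 1]addrC addrK mul1r.
have mN : `|m / N%:R| <= L / N%:R.
  by rewrite normrM [`|_^-1|]ger0_norm ?invr_ge0 ?ler0n// ler_wpM2r// invr_ge0 ltW.
have hE : h = `|e| + L / N%:R + k / N%:R by rewrite /h mulrDl addrA.
have := @normal_prob_itv_ge R (Num.sqrt D) (e + m / N%:R - k / N%:R)
  (e + m / N%:R + k / N%:R) h.
rewrite sqrtr_gt0 => /(_ D0) H; apply: le_trans (H _ _ _); last 3 first.
- by rewrite ltrD2l gtrN.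
- move: mN; rewrite hE ler_norml => /andP[h1 h2].
  by have := ler_normr e e; have := lerNnormlW (lexx `|e|); lra.
- move: mN; rewrite hE ler_norml => /andP[h1 h2].
  by have := ler_norm e; lra.
rewrite lee_fin sqr_sqrtr ?(ltW D0)//.
have -> : e + m / N%:R + k / N%:R - (e + m / N%:R - k / N%:R) = 2 * (k / N%:R) by ring.
rewrite (_ : 2 * _ / N%:R * _ = 2 * (k / N%:R) * (normal_peak (Num.sqrt t) *
  (expR (- ((L + k) ^+ 2 / t)) * expR (- (e ^+ 2 / D))))); last by ring.
apply: ler_wpM2l; first by rewrite mulr_ge0// ltW.
apply: ler_pM; rewrite ?normal_peak_ge0 ?mulr_ge0 ?expR_ge0//.
  by apply: normal_peak_anti; rewrite ?sqrtr_gt0// ler_wsqrtr.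
rewrite -expRD ler_expR -opprD mulNr lerN2.
rewrite ler_pdivrMr; last by rewrite mulrn_wgt0.
have -> : ((L + k) ^+ 2 / t + e ^+ 2 / D) * (D *+ 2) =
    2 * ((L + k) ^+ 2 / N%:R) + 2 * e ^+ 2.
  by rewrite /D; field; rewrite !gt_eqF.
have : ((L + k) / N%:R) ^+ 2 <= (L + k) ^+ 2 / N%:R.
  rewrite exprMn ler_wpM2l ?sqr_ge0// expr2 ger_pMr ?invr_gt0//.
  by rewrite invf_le1.
rewrite /h -[in X in _ -> _ <= X](real_normK (num_real e)).
set X := (L + k) / N%:R; set Y := `|e|; have := sqr_ge0 (Y - X); lra.
Qed.

(** * Lower bound along a good path and the tail of [Xbar] *)

Section tail_estimate.
Context {R : realType} {d1 d2 : measure_display} {T1 : measurableType d1}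
  {T2 : measurableType d2}.
Variables (P1 : probability T1 R) (P2 : probability T2 R).
Variables (B : R -> T1 -> R) (W : R -> T2 -> R).
Variables (beta a b a' b' a0 b0 t : R).
Hypotheses (BB : brownian_motion P1 B) (WW : brownian_motion P2 W).
Hypotheses (aa0 : a < a0) (ab0 : a0 <= b0) (b0b : b0 < b).
Hypotheses (aa' : a <= a') (ab' : a' < b') (b'b : b' <= b) (t0 : 0 < t).

(** The division by 3 matches the three errors of [grid_tube]. The entry [(b' - a') / 2] puts the
    midpoint [y] at distance at least [3 k] from [a'] and [b']. *)
Let k := Num.min (Num.min (a0 - a) (b - b0)) ((b' - a') / 2) / 3.

Let k0 : 0 < k.
Proof. by rewrite divr_gt0// !lt_min !subr_gt0 aa0 b0b/= divr_gt0// subr_gt0. Qed.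

Let k3 : [/\ 3 * k <= a0 - a, 3 * k <= b - b0 & 3 * k <= (b' - a') / 2].
Proof.
have -> : 3 * k = Num.min (Num.min (a0 - a) (b - b0)) ((b' - a') / 2).
  by rewrite mulrC divfK.
by split; rewrite !ge_min lexx ?orbT.
Qed.

Let y := (a' + b') / 2.
(* So small that the Gaussian cost of following [beta W] over one step stays
   below half the exponent of the chaining bound for [B] at scale [k]. *)
Let eta := k / (15 * (1 + `|beta|)).
Let L := b - a.
Let c := k * normal_peak (Num.sqrt t) * expR (- ((L + k) ^+ 2 / t)).

Let c0 : 0 < c.
Proof.
by rewrite /c mulr_gt0 ?expR_gt0// mulr_gt0// normal_peak_gt0// gt_eqF// sqrtr_gt0.
Qed.

Let eta0 : 0 < eta.
Proof. by rewrite divr_gt0// mulr_gt0// ltr_pwDl. Qed.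

Let beta_eta : `|beta| * eta <= k / 15.
Proof.
have bp : 0 < 1 + `|beta| by rewrite ltr_pwDl.
rewrite /eta mulrA ler_pdivrMr ?mulr_gt0//.
rewrite (_ : k / 15 * (15 * (1 + `|beta|)) = k * (1 + `|beta|)); last by field.
by rewrite mulrC ler_pM2l// lerDr.
Qed.

Section good_path.
Variables (N : nat) (w2 : T2).
Hypothesis N0 : (0 < N)%N.
Let D := t / N%:R.
Hypothesis kN : 11 <= k ^+ 2 / (100 * D).
Hypothesis cN : 4 / c * N%:R * expR (- (k ^+ 2 / (200 * t) * N%:R)) <= 1.
Hypothesis tameW : forall i, (i < N)%N -> tame_set W (i%:R * D) D eta w2.
Hypothesis chiW :
  \sum_(i < N) (W (i.+1%:R * D) w2 - W (i%:R * D) w2) ^+ 2 / D <= 145 * N%:R.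

Let Nr0 : 0 < N%:R :> R. Proof. by rewrite ltr0n. Qed.
Let D0 : 0 < D. Proof. by rewrite divr_gt0. Qed.

Let g s := beta * W s w2.
Let dg i := g (i.+1%:R * D) - g (i%:R * D).

Let oscW i s : (i < N)%N -> 0 <= s <= D ->
  `|g (i%:R * D + s) - g (i%:R * D)| <= k / 15.
Proof.
move=> iN sD; rewrite /g -mulrBr normrM; apply: le_trans beta_eta.
rewrite ler_wpM2l// ler_distl.
have [_ cW _ _] := WW.
have iD0 : 0 <= i%:R * D by rewrite mulr_ge0// ltW.
apply: (dyadic_closed_itv (cW w2) iD0 D0) sD => m j jm.
rewrite -ler_distl.
exact: dyadic_tame_bound (ltW eta0) (tameW iN) _ _ jm.
Qed.

(** An increment of at most [k / 15] suffices because [15^2 = 225 >= 200]: its cost stays below half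
    of the chaining exponent [k^2 / (100 D)]. *)
Let dg_sqr i : (i < N)%N -> dg i ^+ 2 / D <= k ^+ 2 / (200 * D).
Proof.
move=> iN.
have -> : k ^+ 2 / (200 * D) = k ^+ 2 / 200 / D by field; rewrite gt_eqF.
rewrite ler_wpM2r ?invr_ge0 ?(ltW D0)//.
have := @oscW i D iN; rewrite lexx ltW// => /(_ isT).
have -> : i%:R * D + D = i.+1%:R * D by rewrite -natr1 mulrDl mul1r.
rewrite -/(dg i) => h.
have : `|dg i| ^+ 2 <= (k / 15) ^+ 2.
  have k15 : 0 <= k / 15 by apply: divr_ge0 => //; exact: ltW.
  by apply: lerXn2r; rewrite ?nnegrE.
rewrite real_normK ?num_real// => /le_trans; apply.
rewrite exprMn ler_wpM2l ?sqr_ge0//; lra.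
Qed.

(** Each window has probability at least twice the factor displayed here. One copy is kept and the
    other pays for the paths of [B] that are not tame: of the exponent [k^2 / (100 D)], one half is
    compared with [dg i ^+ 2 / D] by [dg_sqr], and the other absorbs [4 N / c] by [cN]. *)
Lemma cond_prob_ge x : a0 <= x <= b0 ->
  ((\prod_(i < N) (c / N%:R * expR (- (dg i ^+ 2 / D))))%:E <=
   cond_prob P1 B W beta a b a' b' t x w2)%E.
Proof.
move=> /andP[ax xb]; have [k1 k2 k4] := k3.
have h1 := aa0; have h2 := ab0; have h3 := b0b.
have h4 := aa'; have h5 := ab'; have h6 := b'b.
have [ya yb] : a < y /\ y < b by rewrite /y; split; lra.
have xL : `|y - x| <= L.
  by rewrite ler_norml /L; apply/andP; split; lra.
pose I i : set R := `[dg i + (y - x) / N%:R - k / N%:R, dg i + (y - x) / N%:R + k / N%:R]%classic.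
have q0 i : 0 <= c / N%:R * expR (- (dg i ^+ 2 / D)).
  by rewrite mulr_ge0 ?expR_ge0// divr_ge0// ltW.
have mI i : measurable (I i) by exact: measurable_itv.
have [|S [mS SI PS]] := @tube_lower_bound _ _ _ P1 B BB D k N I
    (fun i => c / N%:R * expR (- (dg i ^+ 2 / D))) D0 (ltW k0) mI (fun i _ => q0 i).
  move=> i iN; have iD0 : 0 <= i%:R * D by rewrite mulr_ge0// ltW.
  have L0 : 0 <= L by rewrite /L; lra.
  have := @increment_window_ge _ _ _ P1 B t k L (dg i) (y - x) N i BB t0 k0 L0 xL N0.
  apply: le_trans.
  apply: le_trans (leeD2l _ (tame_setC_prob BB iD0 D0 (ltW k0) kN)) _.
  rewrite -EFinD lee_fin -/D -/c.
  rewrite (_ : 2 * c / N%:R = c / N%:R + c / N%:R); last by ring.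
  rewrite [leRHS]mulrDl lerD2l.
  apply: (@le_trans _ _ (c / N%:R * expR (- (k ^+ 2 / (200 * D))))); last first.
    rewrite ler_wpM2l ?divr_ge0 ?(ltW c0)// ler_expR lerN2; exact: dg_sqr.
  have e2 : expR (- (k ^+ 2 / (100 * D))) =
      expR (- (k ^+ 2 / (200 * D))) * expR (- (k ^+ 2 / (200 * D))).
    by rewrite -expRD; congr expR; field; rewrite gt_eqF.
  rewrite e2 mulrA ler_wpM2r ?expR_ge0//.
  have := cN.
  have -> : k ^+ 2 / (200 * t) * N%:R = k ^+ 2 / (200 * D).
    by rewrite /D; field; rewrite !gt_eqF.
  set E := expR _ => h.
  have := ler_wpM2l (divr_ge0 (ltW c0) (ltW Nr0)) h.
  rewrite mulr1 (_ : c / N%:R * (4 / c * N%:R * E) = 4 * E)//.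
  by field; rewrite !gt_eqF.
apply: le_trans PS _; apply: le_measure; rewrite ?inE//.
  exact: (measurable_path_tube beta a b a' b' BB WW t0 x w2).
move=> w1 /SI h.
have [B0 _ _ _] := BB; have [W0 _ _ _] := WW.
apply: (@grid_tube R (fun s => B s w1) g N t k x y a b a' b') => //.
- exact: ltW.
- by rewrite /g W0 mulr0.
- move=> i iN; have [] := h i iN; rewrite /I /= in_itv/= => /andP[lo up] _.
  rewrite ler_distl; apply/andP; split; move: lo up; rewrite /dg /D; lra.
- by move=> i iN s sD; have [_] := h i iN; apply.
- move=> i iN s sD; apply: le_trans (oscW iN sD) _.
  by rewrite ler_pdivrMr// ler_peMr// ?ltW//; lra.
- apply/andP; split; lra.
- rewrite /y; apply/andP; split; lra.
- rewrite /y; apply/andP; split; lra.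
Qed.

Lemma Xbar_good_path : (Xbar P1 B W beta a b a' b' a0 b0 t w2 <=
  (N%:R * (ln N%:R + (145 * beta ^+ 2 - ln c)))%:E)%E.
Proof.
pose q := (c / N%:R) ^+ N * expR (- (145 * beta ^+ 2 * N%:R)).
have q0 : 0 < q by rewrite mulr_gt0 ?expR_gt0// exprn_gt0// divr_gt0.
have <- : - ln q = N%:R * (ln N%:R + (145 * beta ^+ 2 - ln c)).
  rewrite /q lnM ?posrE ?expR_gt0 ?exprn_gt0 ?divr_gt0// expRK.
  rewrite lnXn ?divr_gt0// ln_div ?posrE// -mulr_natl; ring.
apply: (@Xbar_le _ _ _ _ _ P1 P2 B W beta a b a' b' a0 b0 t BB WW t0 ab0 w2 q q0) => x xab.
apply: le_trans (cond_prob_ge xab); rewrite lee_fin.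
rewrite big_split/= prodr_const card_ord ler_wpM2l ?exprn_ge0 ?divr_ge0 ?(ltW c0)//.
rewrite -expR_sum ler_expR sumrN lerN2.
rewrite (eq_bigr (fun i : 'I_N => beta ^+ 2 * ((W (i.+1%:R * D) w2 - W (i%:R * D) w2) ^+ 2 / D))).
  rewrite -mulr_sumr (_ : 145 * beta ^+ 2 * N%:R = beta ^+ 2 * (145 * N%:R)); last by ring.
  by rewrite ler_wpM2l ?sqr_ge0.
by move=> i _; rewrite /dg /g -mulrBr exprMn mulrA.
Qed.

End good_path.

(** Both conclusions of the theorem are read off from this bound, [N] being free. The [N] events
    that [W] is not tame on a step contribute [4 N] and the chi-square event at most [N], at the
    smaller of the two rates. *)
Lemma Xbar_tail : exists K c1 : R, exists N0 : nat, 0 < c1 /\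
  forall N, (N0 <= N)%N ->
  (P2 [set w | ((N%:R * (ln N%:R + K))%:E < Xbar P1 B W beta a b a' b' a0 b0 t w)%E]
   <= (5 * N%:R * expR (- (c1 * N%:R)))%:E)%E.
Proof.
pose c1 := Num.min (eta ^+ 2 / (100 * t)) 1.
have c10 : 0 < c1.
  by rewrite lt_min ltr01 andbT divr_gt0 ?exprn_gt0// mulr_gt0.
have ks0 : 0 < k ^+ 2 / (200 * t) by rewrite divr_gt0 ?exprn_gt0// mulr_gt0.
have [N1 hN1] := @linear_expR_le1 R (4 / c) _ (divr_gt0 (ltr0n _ 4) c0) ks0.
(* [1100 = 11 * 100]: this is the threshold of [tame_setC_prob] at scale [eta], and it covers scale
   [k] since [eta <= k]. *)
pose N2 := (Num.truncn (1100 * t / eta ^+ 2)).+1.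
exists (145 * beta ^+ 2 - ln c), c1, (maxn N1 N2); split => // N.
rewrite geq_max => /andP[NN1 NN2].
have N0 : (0 < N)%N by exact: leq_trans NN2.
have Nr0 : 0 < N%:R :> R by rewrite ltr0n.
set D := t / N%:R.
have D0 : 0 < D by rewrite divr_gt0.
have etaN : 11 <= eta ^+ 2 / (100 * D).
  have : 1100 * t / eta ^+ 2 < N%:R.
    by apply: lt_le_trans (truncnS_gt _) _; rewrite ler_nat.
  rewrite ltr_pdivrMr ?exprn_gt0// => h.
  have -> : eta ^+ 2 / (100 * D) = N%:R * eta ^+ 2 / (100 * t).
    by rewrite /D; field; rewrite !gt_eqF.
  by rewrite ler_pdivlMr ?mulr_gt0//; lra.
have kN : 11 <= k ^+ 2 / (100 * D).
  apply: le_trans etaN _; apply: ler_wpM2r.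
    by rewrite invr_ge0 mulr_ge0// ltW.
  apply: lerXn2r; [exact: ltW|exact: ltW|].
  have bp : 0 < 1 + `|beta| by rewrite ltr_pwDl.
  rewrite /eta ler_pdivrMr ?mulr_gt0//; apply: ler_peMr; first exact: ltW.
  by have := normr_ge0 beta; lra.
have iD0 i : 0 <= i%:R * D by rewrite mulr_ge0// ltW.
(* Tameness at level 0 bounds every increment of [W] by [eta], which supplies the cap on the squares
   in [chi_square_tail]. *)
pose M := (Num.truncn (eta ^+ 2 / D)).+1.
have [S [mS SI PS]] := chi_square_tail WW N M D0.
pose bad := \big[setU/set0]_(i < N) ~` tame_set W (i%:R * D) D eta.
have mtame i : measurable (~` tame_set W (i%:R * D) D eta).
  by apply: measurableC; exact: (measurable_tame_set WW).
have mbad : measurable bad by apply: bigsetU_measurable => i _; exact: mtame.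
apply: (@le_trans _ _ (P2 (bad `|` S))).
  apply: le_measure; rewrite ?inE.
  - have := @measurable_Xbar _ _ _ _ _ P1 P2 B W beta a b a' b' a0 b0 t BB WW t0 ab0.
    move=> mX; rewrite -[X in measurable X]setTI.
    exact: emeasurable_fun_o_infty.
  - exact: measurableU.
  move=> w /= Xw.
  have [tw|ntw] := pselect (forall i, (i < N)%N -> tame_set W (i%:R * D) D eta w); last first.
    left; move/existsNP : ntw => [i /not_implyP[iN ni]].
    by rewrite /bad (bigD1 (Ordinal iN))//=; left.
  right; apply: SI; split => /=.
    move=> i iN; rewrite /M; apply: le_lt_trans (truncnS_gt _).
    rewrite ler_wpM2r ?invr_ge0 ?(ltW D0)//.
    have := dyadic_tame_bound (ltW eta0) (tw i iN) (leqnn (2 ^ 0)%N).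
    rewrite dyadic_full => h.
    rewrite -[leLHS]real_normK ?num_real// ler_sqr ?nnegrE ?(ltW eta0)//.
    by rewrite -natr1 mulrDl mul1r.
  rewrite ltNge; apply/negP => chi.
  by move: Xw; rewrite ltNge (@Xbar_good_path N w N0 kN (hN1 _ NN1) tw chi).
apply: le_trans (measureU2 _ mbad mS) _.
have -> : 5 * N%:R * expR (- (c1 * N%:R)) =
   4 * N%:R * expR (- (c1 * N%:R)) + N%:R * expR (- (c1 * N%:R)) by ring.
rewrite EFinD; apply: leeD.
  apply: le_trans (bigsetU_measure_le P2 _ _ _) _; first by move=> i; exact: mtame.
  apply: (@le_trans _ _ (\sum_(i < N) (4 * expR (- (c1 * N%:R)))%:E)%E).
    apply: lee_sum => i _.
    apply: le_trans (tame_setC_prob WW (iD0 i) D0 (ltW eta0) etaN) _.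
    rewrite lee_fin ler_pM2l// ler_expR lerN2.
    have -> : eta ^+ 2 / (100 * D) = eta ^+ 2 / (100 * t) * N%:R.
      by rewrite /D; field; rewrite !gt_eqF.
    by rewrite ler_pM2r// ge_min lexx.
  rewrite sumEFin sumr_const card_ord lee_fin -[_ *+ N]mulr_natr.
  by rewrite mulrAC.
apply: le_trans PS _; rewrite lee_fin.
rewrite -[leLHS]mul1r ler_pM ?expR_ge0// ?ler1n// ler_expR lerN2.
by rewrite ler_piMl ?ge_min ?lexx ?orbT// ltW.
Qed.

End tail_estimate.

(** * Choice of the number of steps and elementary growth estimates *)

Lemma powR_expR {R : realType} (x q : R) : 0 < x -> x `^ q = expR (q * ln x).
Proof. by move=> x0; rewrite /powR gt_eqF. Qed.

(* In terms of [l = ln (ln n)]: the number of steps is [N ~ (ln n) `^ r] with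
   [1 < r < q]. *)
Lemma step_number {R : realType} (K c p q : R) (N0 : nat) :
  0 < c -> 0 < p -> 1 < q -> exists l0 : R, forall l, l0 <= l ->
  exists N : nat, [/\ (N0 <= N)%N, N%:R * (ln N%:R + K) < expR (q * l) &
    expR (p * expR l) * (5 * N%:R * expR (- (c * N%:R))) <= expR (- expR l)].
Proof.
move=> c0 p0 q1; pose r := (1 + q) / 2; pose s := q - r.
have s0 : 0 < s by rewrite /s /r; lra.
have r1 : 0 < r - 1 by rewrite /r; lra.
have c20 : 0 < c / 2 by rewrite divr_gt0.
have [N1 hN1] := @linear_expR_le1 R 5 (c / 2) (ltr0n _ 5) c20.
(* Beyond [C1], [2 (1 + |K| + r) l] is below [(s l)^2 / 2], hence below [exp (s l)]. Beyond [C2],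
   [(c / 2) (r - 1) l], and so [(c / 2) exp ((r - 1) l)], is at least [p + 1]; the extra 1 leaves
   the factor [exp (- exp l)]. *)
pose C1 := 4 * (1 + `|K| + r) / s ^+ 2.
pose C2 := 2 * (p + 1) / (c * (r - 1)).
have C10 : 0 <= C1.
  by rewrite /C1 divr_ge0 ?sqr_ge0// mulr_ge0// addr_ge0 ?addr_ge0//; lra.
have C20 : 0 <= C2.
  by rewrite /C2 divr_ge0 ?mulr_ge0 ?(ltW c0) ?(ltW r1)//; lra.
exists (1 + C1 + C2 + N0%:R + N1%:R) => l hl.
have N00 : 0 <= N0%:R :> R by [].
have N10 : 0 <= N1%:R :> R by [].
have l1 : 1 <= l by lra.
pose N := (Num.truncn (expR (r * l))).+1.
have NL : expR (r * l) < N%:R by exact: truncnS_gt.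
have NU : N%:R <= 2 * expR (r * l).
  have : 1 <= expR (r * l).
    by rewrite -expR0 ler_expR mulr_ge0//; lra.
  rewrite /N -natr1; have := truncn_le (expR (r * l)); rewrite expR_ge0; lra.
have lN : l <= N%:R.
  apply: le_trans (ltW NL); apply: le_trans (expR_ge1Dx _).
  have : 0 <= (r - 1) * l by rewrite mulr_ge0//; lra.
  lra.
have Np : 0 < N%:R :> R by lra.
exists N; split.
- by rewrite -(ler_nat R); lra.
- have lnN : ln N%:R <= 1 + r * l.
    apply: (@le_trans _ _ (ln (2 * expR (r * l)))).
      by rewrite ler_ln ?posrE ?mulr_gt0 ?expR_gt0.
    rewrite lnM ?posrE ?expR_gt0// expRK lerD2r.
    have := @le_ln1Dx R 1 ltac:(lra); by rewrite (_ : 1 + 1 = 2).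
  have h1 : ln N%:R + K <= (1 + `|K| + r) * l.
    have := ler_norm K => KK.
    have : (1 + `|K|) * 1 <= (1 + `|K|) * l.
      by rewrite ler_wpM2l// addr_ge0.
    lra.
  have h2 : 2 * (1 + `|K| + r) * l < expR (s * l).
    have := @expR_ge1Dxn R (s * l) 1.
    have sl0 : 0 <= s * l by rewrite mulr_ge0//; lra.
    move=> /(_ sl0); rewrite (_ : 2`!%:R = 2 :> R)//; apply: lt_le_trans.
    have : C1 < l by lra.
    rewrite /C1 ltr_pdivrMr ?exprn_gt0// => h.
    have lp : 0 < l by lra.
    have := ltr_pM2r lp (4 * (1 + `|K| + r)) (l * s ^+ 2); rewrite h => h'.
    rewrite exprMn [l ^+ 2]expr2; nra.
  have -> : expR (q * l) = expR (r * l) * expR (s * l).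
    by rewrite -expRD /s; congr expR; ring.
  apply: (@le_lt_trans _ _ (N%:R * ((1 + `|K| + r) * l))).
    by rewrite ler_wpM2l.
  apply: (@le_lt_trans _ _ (2 * expR (r * l) * ((1 + `|K| + r) * l))).
    rewrite ler_wpM2r// mulr_ge0//; last lra.
    by rewrite !addr_ge0//; lra.
  by rewrite -mulrA mulrCA ltr_pM2l ?expR_gt0// mulrA.
have hN : 5 * N%:R * expR (- (c / 2 * N%:R)) <= 1.
  by apply: hN1; rewrite -(ler_nat R); lra.
have -> : expR (- (c * N%:R)) = expR (- (c / 2 * N%:R)) * expR (- (c / 2 * N%:R)).
  by rewrite -expRD; congr expR; field.
rewrite [5 * _ * _]mulrA.
apply: (@le_trans _ _ (expR (p * expR l) * (1 * expR (- (c / 2 * N%:R))))).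
  by rewrite ler_wpM2l ?expR_ge0// ler_wpM2r ?expR_ge0.
rewrite mul1r -expRD ler_expR.
have -> : p * expR l - c / 2 * N%:R = (p + 1) * expR l - c / 2 * N%:R - expR l by ring.
suff : (p + 1) * expR l <= c / 2 * expR (r * l).
  have : c / 2 * expR (r * l) <= c / 2 * N%:R by rewrite ler_pM2l// ltW.
  lra.
have -> : expR (r * l) = expR ((r - 1) * l) * expR l.
  by rewrite -expRD; congr expR; ring.
rewrite mulrA ler_pM2r ?expR_gt0//.
apply: (@le_trans _ _ (c / 2 * ((r - 1) * l))); last first.
  rewrite ler_pM2l//; apply: le_trans (expR_ge1Dx _); lra.
have : C2 <= l by lra.
rewrite /C2 ler_pdivrMr ?mulr_gt0//; lra.
Qed.

Lemma geometric_sum_le {R : realType} (x : R) (n : nat) : 0 <= x < 1 ->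
  \sum_(i < n) x ^+ i <= (1 - x)^-1.
Proof.
move=> /andP[x0 x1]; have x10 : 0 < 1 - x by rewrite subr_gt0.
rewrite -[leRHS]mul1r ler_pdivlMr// mulrC -opprB mulNr -subrX1 opprB.
by rewrite lerBlDr lerDl exprn_ge0.
Qed.

Lemma monomial_expR_bounded {R : realType} (c : R) (n : nat) : 0 < c ->
  exists2 F, 0 <= F & forall x, 0 <= x -> x ^+ n.+1 * expR (- (c * x)) <= F.
Proof.
move=> c0; exists ((n.+1)`!%:R / c ^+ n.+1).
  by rewrite divr_ge0// exprn_ge0// ltW.
move=> x x0; rewrite expRN ler_pdivrMr ?expR_gt0// mulrAC ler_pdivlMr ?exprn_gt0//.
have cx0 : 0 <= c * x by rewrite mulr_ge0// ltW.
have := expR_ge1Dxn n cx0; rewrite exprMn => h.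
rewrite mulrC [leRHS]mulrC -ler_pdivrMr ?ltr0n ?fact_gt0//.
by apply: le_trans h; rewrite lerDr.
Qed.

(** * Moments from a tail bound along the squares *)

Section moments.
Context {R : realType} {d : measure_display} {T : measurableType d}.
Variables (P : probability T R) (X : T -> \bar R).
Hypotheses (mX : measurable_fun setT X) (X0 : forall w, (0 <= X w)%E).

(** Layers: if [i.+1] is the first index with [X w <= a i.+1], then [X w ^+ j] is at most the term
    of index [i] in the series of [a i.+1 ^+ j] times the indicator of [a i < X]. Integrating
    termwise leaves polynomial times exponential terms. *)
Lemma moment_finite (A c : R) (N1 j : nat) : 1 <= A -> 0 < c ->
  (forall N, (N1 <= N)%N ->
    (P [set w | ((A * N%:R ^+ 2)%:E < X w)%E] <= (5 * N%:R * expR (- (c * N%:R)))%:E)%E) ->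
  (\int[P]_w (X w) ^+ j < +oo)%E.
Proof.
move=> A1 c0 tailX.
have A0 : 0 <= A by exact: le_trans A1.
pose a i := A * (N1 + i)%:R ^+ 2.
have a0 i : 0 <= a i by rewrite mulr_ge0// sqr_ge0.
have ai i : i%:R <= a i.
  apply: (@le_trans _ _ ((N1 + i)%:R ^+ 2)); last by rewrite ler_peMl// sqr_ge0.
  by rewrite -natrX ler_nat -mulnn; nia.
pose G i := [set w | ((a i)%:E < X w)%E].
have mG i : measurable (G i).
  by rewrite -[X in measurable X]setTI; exact: emeasurable_fun_o_infty.
pose h i w := (((a i.+1) ^+ j)%:E * (\1_(G i) w)%:E)%E.
have h0 i w : (0 <= h i w)%E.
  by rewrite /h -EFinM lee_fin mulr_ge0// exprn_ge0.
have mh i : measurable_fun setT (h i).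
  by apply: emeasurable_funM => //; apply/measurable_EFinP; exact: measurable_indic.
have sum_ge n w : (\sum_(0 <= i < n) h i w <= \sum_(0 <= i <oo) h i w)%E.
  exact: nneseries_lim_ge.
have term_ge i w : (h i w <= \sum_(0 <= i <oo) h i w)%E.
  apply: le_trans (sum_ge i.+1 w); rewrite big_nat_recr//= leeDr//.
  exact: sume_ge0.
have bound w : ((X w) ^+ j <= ((a 0%N) ^+ j)%:E + \sum_(0 <= i <oo) h i w)%E.
  have := X0 w; case Xw : (X w) => [r| |]//.
    rewrite lee_fin => r0; rewrite -EFin_expe.
    have [ra|ar] := leP r (a 0%N).
      apply: lee_paddr; first exact: nneseries_ge0.
      by rewrite lee_fin lerXn2r ?nnegrE.
    have ex : exists i, r <= a i.
      exists (Num.truncn r).+1; apply: le_trans (ai _).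
      exact/ltW/truncnS_gt.
    case: (ex_minnP ex) => -[|i] ri imin; first by rewrite leNgt ar in ri.
    have air : a i < r by rewrite ltNge; apply/negP => /imin; rewrite ltnn.
    apply: lee_paddl; first by rewrite lee_fin exprn_ge0.
    apply: le_trans (term_ge i w); rewrite /h indicE mem_set; last first.
      by rewrite /G/= Xw lte_fin.
    by rewrite mule1 lee_fin lerXn2r ?nnegrE.
  (* Where [X] is infinite every indicator is 1 and every coefficient at least 1, so the series
     diverges and still dominates. *)
  move=> _; suff -> : (\sum_(0 <= i <oo) h i w = +oo)%E by rewrite addey// leey.
  apply: eq_infty => r.
  apply: le_trans (sum_ge (Num.truncn r).+1 w).
  apply: (@le_trans _ _ (\sum_(0 <= i < (Num.truncn r).+1) 1%:E)%E).
    rewrite sumEFin lee_fin big_mkord sumr_const card_ord.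
    exact/ltW/truncnS_gt.
  apply: lee_sum => i _; rewrite /h indicE mem_set; last by rewrite /G/= Xw ltry.
  rewrite mule1 lee_fin exprn_ege1//; apply: le_trans (ai _).
  by rewrite ler1n.
have mXj : measurable_fun setT (fun w => (X w ^+ j)%E).
  elim: j {h h0 mh sum_ge term_ge bound} => [|j IH].
    by under eq_fun do rewrite expe0; exact: measurable_cst.
  by under eq_fun do rewrite expeS; exact: emeasurable_funM.
have mseries : measurable_fun setT (fun w => \sum_(0 <= i <oo) h i w)%E.
  exact: ge0_emeasurable_sum.
apply: (@le_lt_trans _ _ (\int[P]_w (((a 0%N) ^+ j)%:E + \sum_(0 <= i <oo) h i w))%E).
  apply: ge0_le_integral => //.
  - by move=> w _; exact: expe_ge0.
  - by apply: emeasurable_funD.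
rewrite ge0_integralD//; last 2 first.
- by move=> w _; rewrite lee_fin exprn_ge0.
- by move=> w _; exact: nneseries_ge0.
have -> : (\int[P]_w ((a 0%N) ^+ j)%:E)%E = ((a 0%N) ^+ j)%:E.
  by rewrite (integral_cst P measurableT) [X in (_ * X)%E](probability_setT P) mule1.
rewrite integral_nneseries//.
rewrite lte_add_pinfty// ?ltry//.
(* Half of the exponent absorbs a monomial of degree [2 j + 1]: [2 j] from the squares and 1 from
   the prefactor of the tail. The other half is geometric. *)
have [F F0 hF] := @monomial_expR_bounded R (c / 2) j.*2 (divr_gt0 c0 (ltr0n _ 2)).
pose x := expR (- (c / 2)).
have x01 : 0 <= x < 1.
  by rewrite expR_ge0 /x expR_lt1 oppr_lt0 divr_gt0.
pose C := A ^+ j * 5 * expR c * F.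
have C0 : 0 <= C by rewrite !mulr_ge0 ?expR_ge0// exprn_ge0.
apply: (@le_lt_trans _ _ (\sum_(0 <= i <oo) (C * x ^+ i)%:E)%E); last first.
  apply: (@le_lt_trans _ _ (C * (1 - x)^-1)%:E); last by rewrite ltry.
  apply: lime_le.
    apply: is_cvg_nneseries => i _ _; rewrite lee_fin mulr_ge0// exprn_ge0//.
    by case/andP: x01.
  apply: nearW => n; rewrite sumEFin lee_fin big_mkord -mulr_sumr.
  by rewrite ler_wpM2l// geometric_sum_le.
apply: lee_nneseries => [i _ _|i _]; first exact: integral_ge0.
rewrite ge0_integralZl//; last 2 first.
- by apply/measurable_EFinP; exact: measurable_indic.
- by rewrite lee_fin exprn_ge0.
rewrite integral_indic// setIT.
apply: le_trans (lee_wpmul2l _ (tailX _ (leq_addr i N1))) _.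
  by rewrite lee_fin exprn_ge0.
rewrite -EFinM lee_fin.
pose M : R := (N1 + i.+1)%:R.
have M0 : 0 <= M by [].
have ME : (N1 + i)%:R = M - 1 by rewrite /M addnS -natr1 addrK.
have -> : expR (- (c * (N1 + i)%:R)) = expR c * expR (- (c / 2 * M)) * expR (- (c / 2 * M)).
  by rewrite -!expRD ME; congr expR; field.
have xi : expR (- (c / 2 * M)) <= x ^+ i.
  rewrite /x -expRM_natl ler_expR mulrN lerN2 mulrC ler_wpM2l ?divr_ge0 ?(ltW c0)//.
  by rewrite /M ler_nat addnS leqW// leq_addl.
have FM := hF M M0.
rewrite {1}/a -/M exprMn -exprM mul2n.
apply: (@le_trans _ _ (A ^+ j * M ^+ j.*2 * (5 * M * (expR c * expR (- (c / 2 * M)) * x ^+ i)))).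
  rewrite ler_wpM2l ?mulr_ge0 ?exprn_ge0//.
  apply: ler_pM; rewrite ?mulr_ge0 ?expR_ge0//.
    by rewrite ler_wpM2l// ME; lra.
  by rewrite ler_wpM2l ?mulr_ge0 ?expR_ge0.
rewrite (_ : A ^+ j * _ * _ = A ^+ j * 5 * expR c * (M ^+ (j.*2).+1 * expR (- (c / 2 * M))) * x ^+ i); last first.
  by rewrite exprS; ring.
apply: ler_wpM2r; first by apply: exprn_ge0; case/andP: x01.
apply: ler_wpM2l => //.
by rewrite !mulr_ge0 ?expR_ge0// exprn_ge0.
Qed.

End moments.

Theorem theorem3p1 (R : realType) (d1 d2 : measure_display)
    (T1 : measurableType d1) (T2 : measurableType d2)
    (P1 : probability T1 R) (P2 : probability T2 R)
    (B : R -> T1 -> R) (W : R -> T2 -> R)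
    (beta a b a' b' a0 b0 : R) :
  brownian_motion P1 B -> brownian_motion P2 W ->
  a < a0 -> a0 <= b0 -> b0 < b -> a <= a' -> a' < b' -> b' <= b ->
  (forall t p q : R, 0 < t -> 0 < p -> 1 < q ->
     (fun n : nat => (n%:R `^ p) *
        fine (P2 [set w | ((ln n%:R) `^ q)%:E
                          <= Xbar P1 B W beta a b a' b' a0 b0 t w]%E))
     @ \oo --> 0)
  /\
  (forall (j : nat) (t : R), 0 < t ->
     (\int[P2]_w (Xbar P1 B W beta a b a' b' a0 b0 t w) ^+ j < +oo)%E).
Proof.
move=> BB WW aa0 ab0 b0b aa' ab' b'b.
have mX t : 0 < t -> measurable_fun setT (Xbar P1 B W beta a b a' b' a0 b0 t).
  by move=> t0; exact: (@measurable_Xbar _ _ _ _ _ P1 P2).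
have mgt t c : 0 < t ->
    measurable [set w | (c%:E < Xbar P1 B W beta a b a' b' a0 b0 t w)%E].
  move=> /mX mXt; rewrite -[X in measurable X]setTI.
  exact: emeasurable_fun_o_infty.
split=> [t p q t0 p0 q1|j t t0].
  have [K [c [N0 [c0 tail]]]] :=
    Xbar_tail beta BB WW aa0 ab0 b0b aa' ab' b'b t0.
  have [l0 hl0] := step_number K N0 c0 p0 q1.
  (* At [l = ln (ln n)], [step_number] bounds the term of index [n] by [exp (- exp l)], that is
     [1 / n]. *)
  apply: (@squeeze_cvgr _ _ _ _ (fun=> 0) (fun n : nat => n%:R^-1)); last 2 first.
  - exact: cvg_cst.
  - by rewrite -(@cvg_shiftS R (fun n : nat => n%:R^-1)); exact: cvg_harmonic.
  near=> n.
  have nl : expR (expR l0) <= n%:R.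
    near: n; exact: nbhs_infty_ger.
  have n0 : 0 < n%:R :> R by exact: lt_le_trans (expR_gt0 _) nl.
  have L0 : expR l0 <= ln n%:R.
    by rewrite -[leLHS]expRK ler_ln ?posrE ?expR_gt0.
  have Lp : 0 < ln (n%:R : R) by exact: lt_le_trans (expR_gt0 _) L0.
  have l0l : l0 <= ln (ln n%:R).
    by rewrite -[leLHS]expRK ler_ln ?posrE ?expR_gt0.
  rewrite mulr_ge0 ?powR_ge0 ?fine_ge0//=.
  have [N [N0N NK NE]] := hl0 _ l0l.
  rewrite lnK ?posrE// in NE.
  rewrite !powR_expR//.
  have -> : n%:R^-1 = expR (- ln n%:R) :> R by rewrite expRN lnK ?posrE.
  apply: le_trans NE; rewrite ler_wpM2l ?expR_ge0//.
  have mge : measurable [set w | ((expR (q * ln (ln n%:R)))%:E <= Xbar P1 B W beta a b a' b' a0 b0 t w)%E].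
    have mXt := mX t t0; rewrite -[X in measurable X]setTI.
    exact: emeasurable_fun_c_infty.
  rewrite -lee_fin fineK ?fin_num_measure//.
  apply: le_trans (tail N N0N); apply: le_measure; rewrite ?inE//.
    exact: mgt.
  by move=> w /=; apply: lt_le_trans; rewrite lte_fin.
have [K [c [N0 [c0 tail]]]] := Xbar_tail beta BB WW aa0 ab0 b0b aa' ab' b'b t0.
(* Since [ln N <= N - 1], the level [N (ln N + K)] is at most [(1 + |K|) N^2] for [N >= 1], hence
   the maximum with 1. *)
apply: (@moment_finite _ _ _ P2 _ (mX t t0) _ (1 + `|K|) c (maxn N0 1)) => //.
- by move=> w; exact: (@Xbar_ge0 _ _ _ _ _ P1 P2).
- by rewrite lerDl.
move=> N; rewrite geq_max => /andP[NN0 N1]; apply: le_trans (tail N NN0).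
apply: le_measure; rewrite ?inE; [exact: mgt|exact: mgt|].
move=> w /=; apply: le_lt_trans; rewrite lee_fin.
have Nr1 : 1 <= N%:R :> R by rewrite ler1n.
have lnN : ln N%:R <= N%:R - 1 :> R.
  have := @le_ln1Dx R (N%:R - 1); rewrite (_ : 1 + (N%:R - 1) = N%:R); [apply; lra|ring].
have KK := ler_norm K; have K0 := normr_ge0 K.
have : N%:R * (ln N%:R + K) <= N%:R * ((1 + `|K|) * N%:R).
  rewrite ler_wpM2l//.
  have := ler_wpM2l K0 Nr1; lra.
by rewrite expr2 mulrCA.
Unshelve. all: by end_near. Qed.
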